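(* Let $G_1$ and $G_2$ be two simple graphs on disjoint vertex sets and let $G:=G_1\oplus G_2$ be their join. Let $I_1,I_2,I$ be respectively the cover ideals of $G_1,G_2,G$. Suppose $I_1$ and $I_2$ are quasi-equigenerated. The following conditions are equivalent: (1) $I$ is a Freiman ideal. (2) $I_1$ and $I_2$ are both Freiman ideals and at least one of them is of linear type.
   Context: All graphs are finite and simple; vertices are identified with variables of a polynomial ring over a field $k$. The join $G_1\oplus G_2$ has as vertices the union of the vertex sets and as edges those of $G_1$, those of $G_2$, and all pairs $\{x,y\}$ with $x$ a vertex of $G_1$ and $y$ a vertex of $G_2$. For a graph $G$ with vertices $x_1,\dots,x_n$ and edge set $E$, the cover ideal is $J(G)=\bigcap_{\{x_i,x_j\}\in E}(x_i,x_j)\subseteq R=k[x_1,\dots,x_n]$. A monomial ideal $I\subseteq R$ with minimal monomial generators $f_1,\dots,f_t$, $f_j=\prod_{i=1}^n x_i^{c_{ij}}$, is quasi-equigenerated if there is $\alpha=(a_1,\dots,a_n)$ with all $a_i$ positive integers such that $\sum_{i=1}^n a_i c_{ij}$ is the same for all $j$. The fiber cone is $F(I)=\bigoplus_{i\ge0}I^i/\mathfrak m I^i$ with $\mathfrak m=(x_1,\dots,x_n)$; the analytic spread $l(I)$ is the Krull dimension of $F(I)$; $\mu(\cdot)$ is the minimal number of generators. $I$ is of linear type (in this paper's terminology) if $F(I)$ is isomorphic to a polynomial ring over $k$ in $\mu(I)$ variables. A quasi-equigenerated monomial ideal $I$ is a Freiman ideal if $\mu(I^2)=l(I)\mu(I)-\binom{l(I)}{2}$.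 *)

(* Defs.v *)
From HB Require Import structures.
From mathcomp Require Import all_boot all_order all_algebra.
From mathcomp Require Import boolp classical_sets.
From mathcomp Require Import mpoly.

Set Implicit Arguments.
Unset Strict Implicit.
Unset Printing Implicit Defensive.

Import GRing.Theory.

Local Open Scope classical_set_scope.
Local Open Scope ring_scope.
Local Open Scope quotient_scope.

Record sgraph (n : nat) := SGraph {
  adj :> rel 'I_n;
  adj_sym : ssrbool.symmetric adj;
  adj_irr : irreflexive adj
}.

Section Join.
Variables (n1 n2 : nat) (G1 : sgraph n1) (G2 : sgraph n2).

Definition join_adj : rel 'I_(n1 + n2) := fun u v =>
  match split u, split v with
  | inl x, inl y => G1 x y
  | inr x, inr y => G2 x y
  | _, _ => true
  end.

Lemma join_adj_sym : ssrbool.symmetric join_adj.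
Proof.
move=> u v; rewrite /join_adj.
by case: (split u) => x; case: (split v) => y //; apply: adj_sym.
Qed.

Lemma join_adj_irr : irreflexive join_adj.
Proof. by move=> u; rewrite /join_adj; case: (split u) => x; apply: adj_irr. Qed.

Definition join : sgraph (n1 + n2) := SGraph join_adj_sym join_adj_irr.

End Join.

Section Ideals.
Variable A : comNzRingType.
Implicit Types (S I J : set A).

Definition ideal_gen S : set A :=
  [set x | exists2 s : seq (A * A),
     (forall c, c \in s -> S c.2) & x = \sum_(c <- s) c.1 * c.2].

Definition ideal_mul I J : set A :=
  ideal_gen [set x | exists a b, [/\ I a, J b & x = a * b]].

Fixpoint ideal_exp I (i : nat) : set A :=
  if i is j.+1 then ideal_mul I (ideal_exp I j) else setT.

(* [mu_is I m] : m is the minimal number of generators of I *)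
Definition mu_is I (m : nat) : Prop :=
  (exists2 s : seq A, I = ideal_gen [set` s] & size s = m) /\
  (forall s : seq A, I = ideal_gen [set` s] -> (m <= size s)%N).

Lemma ideal_gen0 S : ideal_gen S 0.
Proof. by exists [::] => //; rewrite big_nil. Qed.

Lemma ideal_genD S x y : ideal_gen S x -> ideal_gen S y -> ideal_gen S (x + y).
Proof.
move=> [s Ss ->] [t St ->]; exists (s ++ t); last by rewrite big_cat.
by move=> c; rewrite mem_cat => /orP[/Ss|/St].
Qed.

Lemma ideal_genM S a x : ideal_gen S x -> ideal_gen S (a * x).
Proof.
move=> [s Ss ->]; exists [seq (a * c.1, c.2) | c <- s].
  by move=> _ /mapP[c /Ss cs ->].
by rewrite big_map mulr_sumr; apply: eq_bigr => c _; rewrite mulrA.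
Qed.

Lemma ideal_gen_sub S x : S x -> ideal_gen S x.
Proof.
move=> Sx; exists [:: (1, x)]; last by rewrite big_seq1 mul1r.
by move=> c; rewrite inE => /eqP->.
Qed.

Lemma ideal_gen_ind S (P : A -> Prop) :
  P 0 -> (forall x y, P x -> P y -> P (x + y)) ->
  (forall a x, S x -> P (a * x)) -> forall x, ideal_gen S x -> P x.
Proof.
move=> P0 PD PM x [s Ss ->]; rewrite big_seq; apply: big_ind => // c /Ss.
exact: PM.
Qed.

Lemma ideal_exp0 I i : ideal_exp I i 0.
Proof. by case: i => // i; apply: ideal_gen0. Qed.

Lemma ideal_expD I i x y :
  ideal_exp I i x -> ideal_exp I i y -> ideal_exp I i (x + y).
Proof. by case: i => // i; apply: ideal_genD. Qed.

Lemma ideal_expM I i a x : ideal_exp I i x -> ideal_exp I i (a * x).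
Proof. by case: i => // i; apply: ideal_genM. Qed.

Lemma ideal_exp_mul I i j x y :
  ideal_exp I i x -> ideal_exp I j y -> ideal_exp I (i + j) (x * y).
Proof.
move=> Ix Iy; elim: i x Ix => [|i IHi] x; first by move=> _; apply: ideal_expM.
move=> Ix; rewrite addSn /=; move: x Ix; apply: ideal_gen_ind => [|u v Hu Hv|a u].
- by rewrite mul0r; apply: ideal_gen0.
- by rewrite mulrDl; apply: ideal_genD.
- move=> [b [c [Ib Ic ->]]]; rewrite -!mulrA; apply: ideal_genM.
  by apply: ideal_gen_sub; exists b, (c * y); split=> //; apply: IHi.
Qed.

End Ideals.

Section KrullDimension.
Variable A : comNzRingType.

Definition is_prime_ideal (P : {pred A}) : Prop :=
  idealr_closed P /\ prime_idealr_closed P.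

(* a strictly increasing chain P_0 < ... < P_d of prime ideals *)
Definition prime_chain (d : nat) (P : nat -> {pred A}) : Prop :=
  (forall i, (i <= d)%N -> is_prime_ideal (P i)) /\
  (forall i, (i < d)%N ->
     {subset P i <= P i.+1} /\ ~ {subset P i.+1 <= P i}).

Definition krull_dim_is (d : nat) : Prop :=
  (exists P, prime_chain d P) /\
  (forall e P, prime_chain e P -> (e <= d)%N).

End KrullDimension.

Section FiberCone.
Variables (k : fieldType) (n : nat).
Local Notation R := {mpoly k[n]}.
Variable I : set R.

Definition max_ideal : set R := ideal_gen [set 'X_i | i in [set: 'I_n]].

Lemma max_ideal_coef0 p : max_ideal p -> p@_0%MM = 0.
Proof.
move: p; apply: ideal_gen_ind => [|x y x0 y0|a _ [i _ <-]].
- by rewrite mcoeff0.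
- by rewrite mcoeffD x0 y0 addr0.
- by rewrite rmorphM /= mcoeffX mnm1_eq0 mulr0.
Qed.

(* The direct sum of the I^i, with its graded product, is the Rees algebra
   R[It], the subring of R[t] of those p whose coefficient of t^i lies in I^i. *)
Definition rees_pred : {pred {poly R}} :=
  fun p => `[< forall i, ideal_exp I i p`_i >].

Lemma rees_predP (p : {poly R}) : reflect (forall i, ideal_exp I i p`_i) (p \in rees_pred).
Proof. exact: asboolP. Qed.

Lemma rees_subring : subring_closed rees_pred.
Proof.
split=> [|p q /rees_predP Ip /rees_predP Iq|p q /rees_predP Ip /rees_predP Iq].
- apply/rees_predP => -[//|i]; rewrite coef1; exact: ideal_exp0.
- apply/rees_predP => i; rewrite coefB; apply: ideal_expD => //.
  by rewrite -mulN1r; apply: ideal_expM.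
- apply/rees_predP => i; rewrite coefM.
  apply: big_ind => [|x y|j _]; [exact: ideal_exp0|exact: ideal_expD|].
  by rewrite -{1}(subnKC (ltn_ord j : (j <= i)%N)); apply: ideal_exp_mul.
Qed.

HB.instance Definition _ :=
  GRing.isSubringClosed.Build {poly R} rees_pred rees_subring.

Record rees := Rees { rees_val :> {poly R}; reesP : rees_val \in rees_pred }.

HB.instance Definition _ := [isSub for rees_val].
HB.instance Definition _ := [Choice of rees by <:].
HB.instance Definition _ := [SubChoice_isSubComNzRing of rees by <:].

(* the sum of the m I^i *)
Definition fiber_pred : {pred rees} :=
  fun p => `[< forall i, ideal_mul max_ideal (ideal_exp I i) (val p)`_i >].

Lemma fiber_predP (p : rees) :
  reflect (forall i, ideal_mul max_ideal (ideal_exp I i) (val p)`_i)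
          (p \in fiber_pred).
Proof. exact: asboolP. Qed.

Lemma fiber_idealr : idealr_closed fiber_pred.
Proof.
split=> [||a p q /fiber_predP Ip /fiber_predP Iq].
- by apply/fiber_predP => i; rewrite raddf0 coef0; apply: ideal_gen0.
- apply/negP => /fiber_predP/(_ 0%N); rewrite rmorph1 coef1 /= => H.
  have: max_ideal 1.
    move: 1 H; apply: ideal_gen_ind => [|x y|x _ [b [c [mb _ ->]]]].
    + exact: ideal_gen0.
    + exact: ideal_genD.
    + by rewrite [b * c]mulrC mulrA; apply: ideal_genM.
  by move/max_ideal_coef0/eqP; rewrite mcoeff1 eqxx oner_eq0.
- apply/fiber_predP => i; rewrite rmorphD rmorphM coefD.
  apply: ideal_genD; last exact: Iq.
  rewrite coefM.
  apply: big_ind => [|x y|j _]; [exact: ideal_gen0|exact: ideal_genD|].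
  have /rees_predP/(_ j) := valP a; move: (Ip (i - j)%N).
  set x := _`_j; set y := _`_(i - j) => Hy Hx; move: y Hy.
  apply: ideal_gen_ind => [|u v Hu Hv|b _ [c [e [mc Ie ->]]]].
  + by rewrite mulr0; apply: ideal_gen0.
  + by rewrite mulrDr; apply: ideal_genD.
  + rewrite mulrCA; apply: ideal_genM; rewrite mulrCA.
    apply: ideal_gen_sub; exists c, (x * e); split=> //.
    by rewrite -{1}(subnKC (ltn_ord j : (j <= i)%N)); apply: ideal_exp_mul.
Qed.

HB.instance Definition _ := isIdealr.Build rees fiber_pred fiber_idealr.

(* F(I), the direct sum of the I^i / m I^i *)
Definition fiber_cone : Type := {ideal_quot fiber_pred}.

HB.instance Definition _ := GRing.ComNzRing.on fiber_cone.

Lemma rees_const_subproof (c : k) : (c%:MP)%:P \in rees_pred.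
Proof.
by apply/rees_predP => -[//|i]; rewrite coefC; apply: ideal_exp0.
Qed.

Definition fiber_const (c : k) : fiber_cone :=
  \pi_({ideal_quot fiber_pred}) (Rees (rees_const_subproof c)).

Lemma fiber_constD : {morph fiber_const : a b / a + b}.
Proof.
move=> a b; rewrite /fiber_const -rmorphD; congr (\pi _); apply: val_inj => /=.
by rewrite !rmorphD.
Qed.

Lemma fiber_constM : {morph fiber_const : a b / a * b}.
Proof.
move=> a b; rewrite /fiber_const -rmorphM; congr (\pi _); apply: val_inj => /=.
by rewrite !rmorphM.
Qed.

Lemma fiber_const1 : fiber_const 1 = 1.
Proof.
rewrite /fiber_const -[RHS](rmorph1 \pi_({ideal_quot fiber_pred})).
by congr (\pi _); apply: val_inj => /=; rewrite !rmorph1.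
Qed.

Definition fiber_scale (c : k) (x : fiber_cone) : fiber_cone := fiber_const c * x.

Lemma fiber_scaleA a b x : fiber_scale a (fiber_scale b x) = fiber_scale (a * b) x.
Proof. by rewrite /fiber_scale fiber_constM mulrA. Qed.
Lemma fiber_scale1 : left_id 1 fiber_scale.
Proof. by move=> x; rewrite /fiber_scale fiber_const1 mul1r. Qed.
Lemma fiber_scaleDr : right_distributive fiber_scale +%R.
Proof. by move=> a x y; rewrite /fiber_scale mulrDr. Qed.
Lemma fiber_scaleDl v : {morph fiber_scale^~ v : a b / a + b}.
Proof. by move=> a b; rewrite /fiber_scale fiber_constD mulrDl. Qed.
Lemma fiber_scaleAl a x y : fiber_scale a (x * y) = fiber_scale a x * y.
Proof. exact: mulrA. Qed.

HB.instance Definition _ := GRing.Zmodule_isLmodule.Build k fiber_cone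
  fiber_scaleA fiber_scale1 fiber_scaleDr fiber_scaleDl.
HB.instance Definition _ := GRing.Lmodule_isLalgebra.Build k fiber_cone
  fiber_scaleAl.
HB.instance Definition _ := GRing.Lalgebra_isComAlgebra.Build k fiber_cone.

Definition analytic_spread_is (l : nat) : Prop := krull_dim_is fiber_cone l.

Definition linear_type : Prop :=
  exists2 m : nat, mu_is I m &
  exists f : {lrmorphism fiber_cone -> {mpoly k[m]}}, bijective f.

End FiberCone.

Section Freiman.
Variables (k : fieldType) (n : nat).
Implicit Types (I : set {mpoly k[n]}) (s : seq 'X_{1..n}).

Definition monomial_gen s : set {mpoly k[n]} :=
  ideal_gen [set 'X_[m] | m in [set` s]].

(* s lists (without repetition) the minimal monomial generators of I *)
Definition min_monomial_gens I s : Prop :=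
  I = monomial_gen s /\ (forall m, m \in s -> I <> monomial_gen (rem m s)).

Definition quasi_equigenerated I : Prop :=
  exists2 s, min_monomial_gens I s &
  exists a : 'I_n -> nat, (forall i, 0 < a i)%N /\
  (exists d : nat, forall m, m \in s -> (\sum_(i < n) a i * m i)%N = d).

Definition freiman I : Prop :=
  quasi_equigenerated I /\
  exists l mu1 mu2 : nat,
    [/\ analytic_spread_is I l, mu_is I mu1, mu_is (ideal_exp I 2) mu2 &
        mu2%:Z = l%:Z * mu1%:Z - 'C(l, 2)%:Z].

End Freiman.

Definition cover_ideal (k : fieldType) (n : nat) (G : sgraph n) :
    set {mpoly k[n]} :=
  [set f | forall i j, G i j -> ideal_gen [set 'X_i; 'X_j] f].
Arguments cover_ideal k {n} G.

(* Main.v *)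
From HB Require Import structures.
From mathcomp Require Import all_boot all_order all_algebra.
From mathcomp Require Import zify ring.
From mathcomp Require Import boolp classical_sets.
From mathcomp Require Import mpoly.
Require Import Defs.

(** Let [I] be generated by monomials [x^c], [c] in [s], of the same weighted
degree.  Then [F(I)] is the toric ring of the points [(c, 1)], so that [l(I)] is
the rank [r] of these vectors, [mu(I) = |s|] and [mu(I^2) = |s + s|].
Krull dimension: a chain of primes of length [e] yields [e] elements that satisfy
no polynomial relation, while any [r + 1] elements of the toric ring are related
(the ring embeds into a polynomial ring in [r] variables); conversely a flag of
faces of the cone over the points [(c, 1)] yields a chain of primes of length [r].
Hence [I] is of linear type iff [|s| = r], and Freiman's inequality
[|s + s| >= r |s| - 'C(r, 2)] says that the defect of [I] is nonnegative.
If both vertex sets are nonempty, the minimal generators of the cover ideal of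
the join are the [u x_{V2}] and the [x_{V1} v] for generators [u] and [v] of the
two cover ideals; [r] and [|s|] add up,
[|s + s| = |s1 + s1| + |s2 + s2| + |s1| |s2|], and therefore
[defect = defect1 + defect2 + (|s1| - r1) (|s2| - r2)]. *)

Set Implicit Arguments.
Unset Strict Implicit.
Unset Printing Implicit Defensive.

Import Order.TTheory GRing.Theory Num.Theory.
Local Open Scope ring_scope.

(** * Freiman's inequality *)

Section RowsMx.
Variables (T : eqType) (F : fieldType) (N : nat) (V : T -> 'rV[F]_N).
Implicit Types s t : seq T.

Definition rows_mx s : 'M[F]_(size s, N) :=
  \matrix_(i < size s) V (tnth (in_tuple s) i).

Lemma rows_mx_subP s q (W : 'M_(q, N)) :
  reflect {in s, forall m, (V m <= W)%MS} (rows_mx s <= W)%MS.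
Proof.
apply: (iffP row_subP) => H => [m ms | i].
  have /tnthP[i ->] : m \in in_tuple s by [].
  by have := H i; rewrite rowK.
by rewrite rowK; apply: H; apply: mem_tnth.
Qed.

Lemma rows_mx_mem s m : m \in s -> (V m <= rows_mx s)%MS.
Proof. exact/rows_mx_subP. Qed.

Lemma rows_mx_sub s t : {subset s <= t} -> (rows_mx s <= rows_mx t)%MS.
Proof. by move=> st; apply/rows_mx_subP => m /st; apply: rows_mx_mem. Qed.

Lemma rank_rows_mx_eq s t : s =i t -> \rank (rows_mx s) = \rank (rows_mx t).
Proof.
by move=> st; apply/eqP; rewrite eqn_leq; apply/andP; split;
  apply/mxrankS/rows_mx_sub => x; rewrite st.
Qed.

Lemma rank_rows_mx_cons v s : (\rank (rows_mx (v :: s)) <= (\rank (rows_mx s)).+1)%N.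
Proof.
have: (rows_mx (v :: s) <= V v + rows_mx s)%MS.
  apply/rows_mx_subP => m; rewrite inE => /orP[/eqP->|/rows_mx_mem ms].
    exact: addsmxSl.
  exact: (submx_trans ms (addsmxSr _ _)).
move/mxrankS/leq_trans; apply; apply: leq_trans (mxrank_adds_leqif _ _) _.
by rewrite -[in leqRHS]add1n leq_add ?rank_leq_row.
Qed.

End RowsMx.

Section FreimanInequality.
Variable n : nat.
Implicit Types s t : seq 'X_{1..n}.

(** Duplicates are removed so that the size is a cardinality; for [sumset s s] it becomes
    mu(I^2). *)
Definition sumset s t := undup [seq (a + b)%MM | a <- s, b <- t].

Lemma sumsetP s t m :
  reflect (exists a b, [/\ a \in s, b \in t & m = (a + b)%MM]) (m \in sumset s t).
Proof.
rewrite mem_undup; apply: (iffP allpairsP) => [[[a b] [/= sa tb ->]]|].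
  by exists a, b.
by move=> [a [b [sa tb ->]]]; exists (a, b).
Qed.

Lemma mem_sumset s t a b : a \in s -> b \in t -> (a + b)%MM \in sumset s t.
Proof. by move=> sa tb; apply/sumsetP; exists a, b. Qed.

Variables (N : nat) (V : 'X_{1..n} -> 'rV[rat]_N).
(** [V] only has to respect equalities between sums of two exponents (a Freiman homomorphism of
    order 2); this covers [augv], which is affine but not additive. *)
Hypothesis V_hom : forall a b u v, (a + b = u + v)%MM -> V a + V b = V u + V v.
Local Notation rk s := (\rank (rows_mx V s)).

(* Remove the smallest element v of s and let U be the set of u in s such that
   v + u is not a sum of two remaining elements.  If v + u = a + b with a, b > v,
   then a, b < u; by induction on u, U spans s, so that at least rk s sums are new. *)
Lemma freiman_inequality_sorted s : sorted <%O s ->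
  (rk s * size s <= size (sumset s s) + 'C(rk s, 2))%N.
Proof.
elim: s => [|v t IHt] vt; first by rewrite /= muln0.
have /andP[_ ut] : uniq (v :: t) by apply: sorted_uniq vt; [apply: lt_trans|apply: ltxx].
have {IHt} := IHt (path_sorted vt).
have {vt} /allP vmin : all (> v)%O t by apply: order_path_min vt; apply: lt_trans.
set s := v :: t; set T2 := sumset t t => IHt.
pose U := [seq u <- s | (v + u)%MM \notin T2].
have Vsub x a b u q (W : 'M_(q, N)) : (x + u = a + b)%MM ->
    (V a <= W)%MS -> (V b <= W)%MS -> (V x <= W)%MS -> (V u <= W)%MS.
  by move=> /V_hom/(canRL (addKr _)) -> Wa Wb Wv; rewrite !addmx_sub ?eqmx_opp.
have vU : v \in U.
  rewrite mem_filter mem_head andbT; apply/sumsetP => -[a [b [/vmin va /vmin vb]]].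
  by move=> vv; have := ltm_add va vb; rewrite -vv ltxx.
have uniqU : (size U + size T2 <= size (sumset s s))%N.
  rewrite -(size_map (fun u => v + u)%MM U) -size_cat; apply: uniq_leq_size.
    rewrite cat_uniq undup_uniq andbT map_inj_uniq; last exact: addmI.
    rewrite filter_uniq; last first.
      rewrite /s cons_uniq; apply/andP; split; last exact: ut.
      by apply/negP => /vmin /=; rewrite ltxx.
    apply/hasPn => m mT; apply/mapP => -[u]; rewrite mem_filter => /andP[uT _] me.
    by rewrite -me mT in uT.
  move=> m; rewrite mem_cat => /orP[/mapP[u]|/sumsetP[a [b [at_ bt ->]]]].
    by rewrite mem_filter => /andP[_ us] ->; apply: mem_sumset; rewrite ?mem_head.
  by apply: mem_sumset; rewrite inE ?at_ ?bt orbT.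
have rkU : (rk s <= size U)%N.
  apply: leq_trans (rank_leq_row (rows_mx V U)); apply/mxrankS/rows_mx_subP.
  elim/(well_founded_ind (@ltom_wf n)) => u IHu us.
  have [uU|] := boolP (u \in U); first exact: rows_mx_mem.
  rewrite mem_filter us andbT negbK => /sumsetP[a [b [at_ bt vu]]].
  have [au bu] : (a < u)%O /\ (b < u)%O.
    split; rewrite ltNge; apply/negP => le.
      by have := ltmc_le_add (vmin b bt) le; rewrite vu addmC ltxx.
    by have := ltmc_le_add (vmin a at_) le; rewrite vu ltxx.
  have ats : a \in s by rewrite inE at_ orbT.
  have bts : b \in s by rewrite inE bt orbT.
  by have := Vsub v a b u _ _ vu (IHu a au ats) (IHu b bu bts); apply; apply: rows_mx_mem.
have rk_cons : (rk s <= (rk t).+1)%N := rank_rows_mx_cons V v t.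
have rk_s : (rk t <= rk s)%N.
  by apply/mxrankS/rows_mx_sub => x xt; rewrite inE xt orbT.
(* If [v] adds nothing to the rank, the left side grows by [rk t], which the new sums [v + u] pay
   for. *)
have [rk_eq|rk_ne] := eqVneq (rk t) (rk s).
  rewrite -rk_eq in rkU *; rewrite mulnS.
  by rewrite (leq_trans (leq_add rkU IHt)) // addnA leq_add2r.
have rkE : rk s = (rk t).+1 by lia.
(* If the rank grows, no [u] in [t] satisfies v + u = a + b, as [v] would then lie in the span of
   [t]; so all [size s] sums [v + u] are new, and the binomial grows by [rk t]. *)
have US : U = s.
  apply/all_filterP/allP => u us; apply/sumsetP => -[a [b [at_ bt vu]]].
  move: us; rewrite inE => /orP[/eqP uv|ut'].
    by have := ltm_add (vmin a at_) (vmin b bt); rewrite -vu uv ltxx.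
  have: (rows_mx V s <= rows_mx V t)%MS.
    apply/rows_mx_subP => w; rewrite inE => /orP[/eqP->|]; last exact: rows_mx_mem.
    by apply: (Vsub u a b); rewrite ?rows_mx_mem // addmC.
  by move/mxrankS; rewrite rkE ltnn.
rewrite US in uniqU; rewrite rkE binS bin1.
suff arith r l c p q : (r * l <= p + c -> l.+1 + p <= q -> r.+1 * l.+1 <= q + (c + r))%N.
  exact: arith IHt uniqU.
rewrite mulnS mulSn; move: (r * l)%N => x; lia.
Qed.

Lemma freiman_inequality s : uniq s ->
  (rk s * size s <= size (sumset s s) + 'C(rk s, 2))%N.
Proof.
move=> us; pose t := sort <=%O s.
have st : t =i s by move=> x; rewrite mem_sort.
have := @freiman_inequality_sorted t; rewrite sort_lt_sorted us => /(_ isT).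
rewrite (rank_rows_mx_eq V st) size_sort; congr (_ <= _ + _)%N.
apply/perm_size/uniq_perm; rewrite ?undup_uniq // => m.
by apply/sumsetP/sumsetP => -[a [b [sa sb ->]]]; exists a, b; rewrite ?st // -?st.
Qed.

End FreimanInequality.

(** * Monomial ideals *)

Section Ideals.
Variable A : comNzRingType.
Implicit Types (S : set A) (I J : set A).

Lemma ideal_gen_sum (T : Type) S (r : seq T) (P : pred T) (F : T -> A) :
  (forall i, P i -> ideal_gen S (F i)) -> ideal_gen S (\sum_(i <- r | P i) F i).
Proof.
move=> SF; apply: big_ind => //; first exact: ideal_gen0.
by move=> x y; apply: ideal_genD.
Qed.

Lemma mu_is_uniq I m1 m2 : mu_is I m1 -> mu_is I m2 -> m1 = m2.
Proof.
move=> [[s1 Is1 <-] H1] [[s2 Is2 <-] H2].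
by apply/eqP; rewrite eqn_leq H1 ?H2.
Qed.

(** [ideal_exp] ends in the unit ideal, so a first power unfolds to a product with [setT]. *)
Lemma ideal_mulT S : ideal_mul (ideal_gen S) setT = ideal_gen S.
Proof.
apply/seteqP; split=> x; last first.
  by move=> Sx; apply: ideal_gen_sub; exists x, 1; rewrite mulr1.
move: x; apply: ideal_gen_ind => [|x y|a _ [b [c [Sb _ ->]]]].
- exact: ideal_gen0.
- exact: ideal_genD.
- by rewrite [b * c]mulrC; do 2!apply: ideal_genM.
Qed.

End Ideals.

(** * Weighted degrees of exponents *)

Section Weight.
Variables (n : nat) (a : 'I_n -> nat).
Implicit Types m u : 'X_{1..n}.

Definition wt m := (\sum_(i < n) a i * m i)%N.

Lemma wt0 : wt 0%MM = 0%N.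
Proof. by rewrite /wt big1 // => i _; rewrite mnm0E muln0. Qed.

Lemma wtD m u : wt (m + u)%MM = (wt m + wt u)%N.
Proof. by rewrite /wt -big_split; apply: eq_bigr => i _; rewrite mnmDE mulnDr. Qed.

Hypothesis a_gt0 : forall i, (0 < a i)%N.

Lemma wt_eq0 m : (wt m == 0%N) = (m == 0%MM).
Proof.
apply/eqP/eqP => [|->]; last exact: wt0.
move=> /eqP; rewrite sum_nat_eq0 => /forallP w0; apply/mnmP => i.
by have := w0 i; rewrite muln_eq0 mnm0E eqn0Ngt a_gt0 => /eqP.
Qed.

Lemma wt_le m u : (u <= m)%MM -> (wt u <= wt m)%N.
Proof. by move=> um; rewrite -(submK um) wtD leq_addl. Qed.

Lemma wt_le_eq m u : (u <= m)%MM -> wt u = wt m -> u = m.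
Proof.
move=> um; rewrite -{1}(submK um) wtD => w.
have /eqP : wt (m - u)%MM = 0%N by lia.
by rewrite wt_eq0 => /eqP mu0; rewrite -(submK um) mu0 add0m.
Qed.

(** Every nonconstant monomial of [p] has positive weight and pushes the terms of [q] above weight
    [d]. *)
Lemma mcoeffM_wt_min (R : nzRingType) (d : nat) (p q : {mpoly R[n]}) z :
  {in msupp q, forall m, d <= wt m}%N -> wt z = d -> (p * q)@_z = p@_0%MM * q@_z.
Proof.
move=> q_ge wz.
rewrite -{1}(subrK (p@_0)%:MP p) mulrDl mcoeffD mcoeffCM -[RHS]add0r.
congr (_ + _); apply: memN_msupp_eq0; apply/negP => /msuppM_le /allpairsP[[m u]].
case=> /=; rewrite mcoeff_msupp mcoeffB mcoeffC => pm /q_ge du zE.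
have := wtD m u; rewrite -zE wz => wE.
have /eqP : wt m = 0%N by lia.
by rewrite wt_eq0 => /eqP m0; rewrite m0 eqxx mulr1 subrr eqxx in pm.
Qed.

End Weight.

(** * Membership and minimal generators of monomial ideals *)

Section MonomialIdeals.
Variables (k : fieldType) (n : nat).
Implicit Types (s t : seq 'X_{1..n}) (m u : 'X_{1..n}) (f : {mpoly k[n]}).

Lemma monomial_genP s f :
  monomial_gen s f <-> {in msupp f, forall m, exists2 u, u \in s & (u <= m)%MM}.
Proof.
split=> [|sf].
  move: f; apply: ideal_gen_ind => [m|x y sx sy m|p _ [u us <-] m].
  - by rewrite msupp0.
  - by move/msuppD_le; rewrite mem_cat => /orP[/sx|/sy].
  - move/msuppM_le/allpairsP => [[v w]] /=; rewrite msuppX inE => -[_ /eqP-> ->].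
    by exists u => //; apply: lem_addl.
rewrite [f]mpolyE big_seq; apply: ideal_gen_sum => m /sf[u us um].
rewrite -mul_mpolyC -(submK um) mpolyXD mulrA; apply: ideal_genM.
by apply: ideal_gen_sub; exists u.
Qed.

Lemma monomial_genX s m :
  monomial_gen s ('X_[m] : {mpoly k[n]}) <-> exists2 u, u \in s & (u <= m)%MM.
Proof.
split=> [/monomial_genP|[u us um]]; first by apply; rewrite msuppX inE.
by apply/monomial_genP => v; rewrite msuppX inE => /eqP->; exists u.
Qed.

Lemma monomial_gen_ext s t : s =i t -> monomial_gen s = monomial_gen t :> set {mpoly k[n]}.
Proof.
move=> st; apply/seteqP; split=> f /monomial_genP sf; apply/monomial_genP => m /sf.
  by case=> u us um; exists u; rewrite -?st.
by case=> u us um; exists u; rewrite ?st.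
Qed.

Lemma ideal_mul_monomial s t :
  ideal_mul (monomial_gen s) (monomial_gen t) =
  monomial_gen (sumset s t) :> set {mpoly k[n]}.
Proof.
apply/seteqP; split=> f; move: f; apply: ideal_gen_ind.
- exact: ideal_gen0.
- by move=> x y; apply: ideal_genD.
- move=> p _ [b [c [/monomial_genP sb /monomial_genP tc ->]]]; apply: ideal_genM.
  apply/monomial_genP => m /msuppM_le /allpairsP[[v w] /= [/sb[v1 sv1 le1] /tc[w1 tw1 le2] ->]].
  exists (v1 + w1)%MM; first exact: mem_sumset.
  by apply/mnm_lepP => i; rewrite !mnmDE leq_add // (mnm_lepP _ _).
- exact: ideal_gen0.
- by move=> x y; apply: ideal_genD.
- move=> p _ [_ /sumsetP[u [v [us vt ->]]] <-]; apply: ideal_genM.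
  apply: ideal_gen_sub; exists 'X_[u], 'X_[v]; rewrite mpolyXD; split=> //.
    by apply: ideal_gen_sub; exists u.
  by apply: ideal_gen_sub; exists v.
Qed.

Lemma ideal_exp2_monomial s :
  ideal_exp (monomial_gen s) 2 = monomial_gen (sumset s s) :> set {mpoly k[n]}.
Proof. by rewrite /= ideal_mulT ideal_mul_monomial. Qed.

(** [rem] deletes one occurrence only, so deleting a repeated exponent would leave the ideal
    unchanged. *)
Lemma min_monomial_gens_uniq (I : set {mpoly k[n]}) s :
  min_monomial_gens I s -> uniq s.
Proof.
move=> [Is smin]; apply/negPn/negP => us.
have [m ms mrem] : exists2 m, m \in s & m \in rem m s.
  elim: s {Is smin} us => //= m s IHs; rewrite negb_and negbK => /orP[ms|us].
    by exists m; rewrite ?eqxx ?inE ?eqxx.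
  have [u us' ur] := IHs us; exists u; first by rewrite inE us' orbT.
  by case: eqP => // _; rewrite inE ur orbT.
apply: (smin m ms); rewrite Is; apply: monomial_gen_ext => x.
by rewrite (perm_mem (perm_to_rem ms)) inE; case: eqP => // ->; rewrite mrem.
Qed.

Variables (a : 'I_n -> nat) (d : nat).
Hypothesis a_gt0 : forall i, (0 < a i)%N.

(** Between exponents of equal weight divisibility is equality, so no generator is a multiple of
    another. *)
Lemma equigenerated_min s : uniq s -> {in s, forall m, wt a m = d} ->
  min_monomial_gens (monomial_gen s : set {mpoly k[n]}) s.
Proof.
move=> us ws; split=> // m ms E.
have: monomial_gen s ('X_[m] : {mpoly k[n]}).
  by apply/monomial_genX; exists m => //; apply: lepm_refl.
rewrite E => /monomial_genX[u ur um].
have uE : u = m by apply: (wt_le_eq a_gt0 um); rewrite (ws u) ?(ws m) ?(mem_rem ur).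
by move: ur; rewrite uE mem_rem_uniq // inE eqxx.
Qed.

(** For the lower bound, [phi] reads off the coefficients at the exponents in [s], which amounts to
    passing to I/mI; the images of any generating list must span a space of dimension [size s]. *)
Lemma mu_is_equigenerated s : uniq s -> {in s, forall m, wt a m = d} ->
  mu_is (monomial_gen s : set {mpoly k[n]}) (size s).
Proof.
move=> us ws; split.
  exists [seq 'X_[m] | m <- s]; last by rewrite size_map.
  rewrite /monomial_gen; congr ideal_gen; apply/seteqP; split=> [_ [m ms <-]|_ /mapP[m ms ->]].
    exact: map_f.
  by exists m.
move=> t E; pose phi (f : {mpoly k[n]}) := \row_(i < size s) f@_(tnth (in_tuple s) i).
apply: leq_trans (rank_leq_row (rows_mx phi t)).
apply: (@leq_trans (\rank (1%:M : 'M[k]_(size s)))); first by rewrite mxrank1.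
apply/mxrankS/row_subP => i.
have: monomial_gen s ('X_[tnth (in_tuple s) i] : {mpoly k[n]}).
  by apply/monomial_genX; exists (tnth (in_tuple s) i); [apply: mem_tnth|apply: lepm_refl].
rewrite E => -[r rt Xi].
(* In weight [d] a multiplier acts through its constant term alone. *)
suff -> : row i 1%:M = \sum_(c <- r) c.1@_0%MM *: phi c.2.
  by rewrite big_seq summx_sub // => c /rt /= ct; rewrite scalemx_sub ?rows_mx_mem.
apply/rowP => j; rewrite summxE !mxE.
have -> : (i == j) = (tnth (in_tuple s) i == tnth (in_tuple s) j).
  by apply/eqP/eqP => [->//|/(tuple_uniqP (in_tuple s) us)].
rewrite -mcoeffX Xi raddf_sum /= !big_seq; apply: eq_bigr => c /rt /= ct.
rewrite !mxE (@mcoeffM_wt_min _ a a_gt0 _ d) // ?ws ?mem_tnth // => m mc.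
have /monomial_genP/(_ _ mc)[u /ws <-] : monomial_gen s c.2 by rewrite E; apply: ideal_gen_sub.
exact: wt_le.
Qed.

End MonomialIdeals.

(** * Krull dimension of toric rings *)

Section PrimeIdeals.
Variables (A : comNzRingType) (P : {pred A}).
Hypothesis primeP : is_prime_ideal P.

Lemma prime_ideal0 : 0 \in P.
Proof. by case: primeP => -[]. Qed.

Lemma prime_idealD x y : x \in P -> y \in P -> x + y \in P.
Proof. by case: primeP => -[_ _ PD] _ xP yP; rewrite -[x]mul1r PD. Qed.

Lemma prime_idealMl a x : x \in P -> a * x \in P.
Proof. by case: primeP => -[P0 _ PD] _ xP; rewrite -[a * x]addr0 PD. Qed.

Lemma prime_idealMr a x : x \in P -> x * a \in P.
Proof. by rewrite mulrC; apply: prime_idealMl. Qed.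

Lemma prime_idealB x y : x \in P -> y \in P -> x - y \in P.
Proof. by move=> xP yP; rewrite prime_idealD // -mulN1r prime_idealMl. Qed.

Lemma prime_ideal_sum (T : eqType) (r : seq T) (Q : pred T) (F : T -> A) :
  (forall i, i \in r -> Q i -> F i \in P) -> \sum_(i <- r | Q i) F i \in P.
Proof.
move=> FP; rewrite big_seq_cond; apply: (big_ind (fun y => y \in P)) => [||i /andP[]].
- exact: prime_ideal0.
- exact: prime_idealD.
- exact: FP.
Qed.

Lemma prime_idealM x y : x * y \in P -> x \in P \/ y \in P.
Proof. by case: primeP => _ pP /pP/orP. Qed.

Lemma prime_idealX a m : a \notin P -> a ^+ m \notin P.
Proof.
move=> aP; elim: m => [|m IHm]; first by rewrite expr0; case: primeP => -[].
by rewrite exprS; apply/negP => /prime_idealM[]; apply/negP.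
Qed.

End PrimeIdeals.

(** * Algebraic independence along a chain of primes *)

Section PrimeChains.
Variables (A : comNzRingType) (k : fieldType) (kappa : {rmorphism k -> A}).

(* Q is the polynomial with coefficients c and exponents E.  Divide it by the
   largest power of the first variable (x 0 is not in P 0), then reduce modulo
   x 0, which lies in P 1. *)
Lemma prime_chain_independent e (P : nat -> {pred A}) (x : nat -> A)
    (T : eqType) (ss : seq T) (c : T -> k) (E : T -> seq nat) :
  prime_chain e P -> (forall i, (i < e)%N -> x i \in P i.+1 /\ x i \notin P i) ->
  ss != [::] -> uniq (map E ss) -> {in ss, forall t, c t != 0} ->
  {in ss, forall t, size (E t) = e} ->
  \sum_(t <- ss) kappa (c t) * \prod_(i < e) x i ^+ nth 0%N (E t) i \notin P 0%N.
Proof.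
elim: e P x ss E => [|e IHe] P x ss E [Pprime Pchain] xP ss0 uss css Ess.
  have P0 := Pprime 0%N isT.
  (* Without variables all exponents are empty, so distinctness leaves a single nonzero constant,
     which is a unit. *)
  case: ss => [//|t [|u ss]] in ss0 uss css Ess *; last first.
    move: uss => /= /andP[]; rewrite inE negb_or => /andP[/negP[]].
    by rewrite (size0nil (Ess t _)) ?(size0nil (Ess u _)) ?inE ?eqxx ?orbT.
  rewrite big_seq1 big_ord0 mulr1; apply/negP => /(prime_idealMl P0 (kappa (c t)^-1)).
  rewrite -rmorphM mulVf ?css ?inE // rmorph1.
  by case: P0 => -[_ /negP].
pose h t := head 0%N (E t).
have P0 := Pprime 0%N isT; have P1 := Pprime 1%N isT.
have [x1 x0] := xP 0%N isT.
have [t0 t0s t0min] : exists2 t, t \in ss & {in ss, forall u, h t <= h u}%N.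
  case: ss ss0 {uss css Ess} => // t ss _; elim: ss t => [|u ss IHs] t.
    by exists t => [|v]; rewrite ?mem_head // inE => /eqP->.
  have [v vs vmin] := IHs u; have [le|lt] := leqP (h t) (h v).
    exists t; rewrite ?mem_head // => w; rewrite inE => /orP[/eqP->//|/vmin].
    exact: leq_trans.
  exists v; rewrite 1?inE ?vs ?orbT // => w; rewrite inE => /orP[/eqP->|/vmin//].
  exact: ltnW.
pose G t := kappa (c t) * \prod_(i < e) x i.+1 ^+ nth 0%N (behead (E t)) i.
have GE t : kappa (c t) * \prod_(i < e.+1) x i ^+ nth 0%N (E t) i = x 0%N ^+ h t * G t.
  rewrite big_ord_recl mulrCA nth0; congr (_ * (_ * _)).
  by apply: eq_bigr => i _; rewrite nth_behead.
have -> : \sum_(t <- ss) kappa (c t) * \prod_(i < e.+1) x i ^+ nth 0%N (E t) i =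
    x 0%N ^+ h t0 * \sum_(t <- ss) x 0%N ^+ (h t - h t0) * G t.
  rewrite mulr_sumr !big_seq; apply: eq_bigr => t /t0min tmin.
  by rewrite GE mulrA -exprD subnKC.
apply/negP => /(prime_idealM P0)[]; first exact/negP/prime_idealX.
move=> /(Pchain 0%N isT).1; rewrite (bigID (fun t => h t == h t0)) /=.
set S1 := bigop _ _ _; set S2 := bigop _ _ _ => S12.
have S2P : S2 \in P 1%N.
  apply: (prime_ideal_sum P1) => t ts tn; apply: (prime_idealMr P1).
  have -> : (h t - h t0)%N = (h t - h t0).-1.+1.
    by rewrite prednK // subn_gt0 ltn_neqAle eq_sym tn t0min.
  by rewrite exprS; apply: (prime_idealMr P1).
have: S1 \in P 1%N by rewrite -(addrK S2 S1) (prime_idealB P1).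
rewrite /S1 -big_filter; set ss1 := filter _ _.
have ss1E t : t \in ss1 -> t \in ss /\ E t = h t0 :: behead (E t).
  rewrite mem_filter => /andP[/eqP <- ts]; split=> //; rewrite /h.
  by have := Ess t ts; case: (E t).
rewrite big_seq (eq_bigr G) -?big_seq; last first.
  by move=> t; rewrite mem_filter => /andP[/eqP-> _]; rewrite subnn expr0 mul1r.
(* The first exponent is constant on [ss1], so the exponents stay distinct after it is dropped. *)
apply/negP; apply: (IHe (fun i => P i.+1) (fun i => x i.+1) ss1 (behead \o E)).
- by split=> i ie; [apply: Pprime | apply: Pchain].
- by move=> i ie; apply: xP.
- by apply/eqP => ss10; have: t0 \in ss1; [rewrite mem_filter eqxx|rewrite ss10].
- rewrite map_comp map_inj_in_uniq; last first.
    by move=> _ _ /mapP[t /ss1E[_ ->] ->] /mapP[u /ss1E[_ ->] ->] /= ->.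
  by apply: subseq_uniq uss; apply: map_subseq; apply: filter_subseq.
- by move=> t /ss1E[/css].
- by move=> t /ss1E[/Ess Et _]; rewrite /= size_behead Et.
Qed.

End PrimeChains.

(** * Algebraic dependence of r + 1 polynomials in r variables *)

Section AlgebraicDependence.
Variables (k : fieldType) (r : nat).
Implicit Types p q : {mpoly k[r]}.

Lemma msizeX_le (d m : nat) p : (msize p <= d.+1 -> msize (p ^+ m) <= (d * m).+1)%N.
Proof.
move=> pd; elim: m => [|m IHm]; first by rewrite expr0 msize1.
rewrite exprS; have [->|p0] := eqVneq p 0; first by rewrite mul0r msize0.
have [->|q0] := eqVneq (p ^+ m) 0; first by rewrite mulr0 msize0.
by rewrite msizeM // mulnS; move: (msize p) (msize (p ^+ m)) (d * m)%N pd IHm => x y z; lia.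
Qed.

Lemma msize_prod_le (I : finType) (d : nat) (F : I -> {mpoly k[r]}) :
  (forall i, msize (F i) <= d.+1)%N -> (msize (\prod_i F i) <= (d * #|I|).+1)%N.
Proof.
move=> Fd; rewrite cardE -[index_enum I]enumT; elim: (enum I) => [|i s IHs].
  by rewrite big_nil msize1.
rewrite big_cons; have [->|p0] := eqVneq (F i) 0; first by rewrite mul0r msize0.
set q := bigop _ _ _ in IHs *.
have [->|q0] := eqVneq q 0; first by rewrite mulr0 msize0.
rewrite msizeM //= mulnS; have := Fd i.
by move: (msize (F i)) (msize q) (d * size s)%N IHs => x y z; lia.
Qed.

(* Counting: the (M + 1)^(r + 1) products of powers of exponent at most M lie in
   a space of dimension O(M^r). *)
Lemma mpoly_algebraic_dependence (g : 'I_r.+1 -> {mpoly k[r]}) :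
  exists M (c : {ffun 'I_r.+1 -> 'I_M} -> k), [exists x, c x != 0] /\
    \sum_x c x *: \prod_i g i ^+ x i = 0.
Proof.
(* All products have size at most [K], and K <= C M; hence K^r <= C^r M^r < M^(r+1) by the choice of
   [M], and [B] has more rows than columns. *)
pose D := (\max_i msize (g i))%N.
pose C := (D * r.+1).+1; pose M := (C ^ r).+1; pose K := (D * M * r.+1).+1.
pose X := {ffun 'I_r.+1 -> 'I_M}; pose Y := {ffun 'I_r -> 'I_K}.
pose F (x : X) := \prod_i g i ^+ x i.
have gD i : (msize (g i) <= D.+1)%N.
  by apply/leqW/(@leq_bigmax _ (fun i => msize (g i))).
have FK x : (msize (F x) <= K)%N.
  have := @msize_prod_le _ (D * M) (fun i => g i ^+ x i); rewrite card_ord; apply.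
  move=> i; apply: leq_trans (msizeX_le (x i) (gD i)) _.
  by rewrite ltnS leq_mul2l ltnW ?orbT.
pose mY (y : Y) : 'X_{1..r} := [multinom (y i : nat) | i < r].
pose B : 'M[k]_(#|X|, #|Y|) := \matrix_(i, j) (F (enum_val i))@_(mY (enum_val j)).
have : kermx B != 0.
  rewrite kermx_eq0 /row_free; apply/eqP => rB.
  have := rank_leq_col B; rewrite rB !card_ffun !card_ord leqNgt.
  suff -> : (K ^ r < M ^ r.+1)%N by [].
  have KCM : (K <= C * M)%N by rewrite /K /C; lia.
  have mono x y e : (x <= y -> x ^ e <= y ^ e)%N.
    by case: e => [//|e]; rewrite leq_exp2r.
  apply: leq_ltn_trans (mono _ _ r KCM) _.
  by rewrite expnMn expnS ltn_mul2r expn_gt0 ltnS leqnn.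
move/rowV0Pn => [v /sub_kermxP vB v0].
exists M, (fun x => v 0 (enum_rank x)); split.
  have [j vj] : exists j, v 0 j != 0.
    by apply/existsP; apply: contraNT v0 => /existsPn v0; apply/eqP/rowP => j;
       rewrite mxE; apply/eqP; have := v0 j; rewrite negbK.
  by apply/existsP; exists (enum_val j); rewrite enum_valK.
apply/mpolyP => m; rewrite mcoeff0 raddf_sum /=.
(* The columns of [B] cover the monomials with all exponents below [K]; any other monomial has too
   large a degree to occur. *)
have [/forallP mK | /forallPn[i mi]] := boolP [forall i, m i < K]%N; last first.
  rewrite big1 // => x _; rewrite mcoeffZ memN_msupp_eq0 ?mulr0 //.
  apply: msize_mdeg_ge; apply: leq_trans (FK x) _; rewrite -leqNgt in mi.
  by apply: leq_trans mi _; rewrite mdegE (bigD1 i) //= leq_addr.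
pose y : Y := [ffun i => Ordinal (mK i)].
have yE : mY y = m by apply/mnmP => i; rewrite mnmE ffunE.
move/rowP/(_ (enum_rank y)): vB; rewrite !mxE => {2}<-.
rewrite (reindex (@enum_val X predT)) /=; last first.
  by apply: onW_bij; apply: enum_val_bij.
by apply: eq_bigr => i _; rewrite mcoeffZ enum_valK !mxE enum_rankK yE.
Qed.

End AlgebraicDependence.

(** * Toric maps and faces of the cone *)

Section Toric.
Variables (k : fieldType) (mu N : nat) (e : 'I_mu -> 'X_{1..N}).
Implicit Types (al be : 'X_{1..mu}) (f : {mpoly k[mu]}) (S : {set 'I_mu}).

Definition expo al : 'X_{1..N} := (\sum_j e j *+ al j)%MM.

Lemma expoE al i : expo al i = (\sum_j e j i * al j)%N.
Proof. by rewrite /expo mnm_sumE; apply: eq_bigr => j _; rewrite mulmnE. Qed.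

Definition msupp_in S al := [forall j, (j \notin S) ==> (al j == 0%N)].

(** Killing the variables outside [S] makes the kernel the ideal attached to [S]; the full set gives
    the toric ring itself. *)
Definition toric_mor S : {rmorphism {mpoly k[mu]} -> {mpoly k[N]}} :=
  mmap (@mpolyC N k) (fun j => if j \in S then 'X_[e j] else 0).

Lemma toric_morX S al : toric_mor S 'X_[al] = if msupp_in S al then 'X_[expo al] else 0.
Proof.
rewrite /toric_mor /= mmapX /mmap1; case: ifP => [/forallP alS | /negbT /forallPn[j]].
  rewrite /expo -mprodXnE; apply: eq_bigr => j _.
  by have := alS j; case: (j \in S) => //= /eqP->; rewrite !expr0.
rewrite negb_imply => /andP[/negbTE jS aj].
by rewrite (bigD1 j) //= jS expr0n (negbTE aj) mul0r.
Qed.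

Lemma toric_mor_coef S f m :
  (toric_mor S f)@_m = \sum_(al <- msupp f | msupp_in S al && (expo al == m)) f@_al.
Proof.
rewrite {1}[f]mpolyE rmorph_sum raddf_sum [RHS]big_mkcond; apply: eq_bigr => al _.
rewrite -mul_mpolyC rmorphM toric_morX /toric_mor /= mmapC mcoeffCM.
case: (msupp_in S al) => /=; last by rewrite mcoeff0 mulr0.
by rewrite mcoeffX; case: eqP; rewrite ?mulr1 ?mulr0.
Qed.

(** A combinatorial form of a face of the cone over the points [e j]: no monomial relation leads out
    of [S]. *)
Definition is_face S :=
  forall al be, expo al = expo be -> msupp_in S al -> msupp_in S be.

Lemma msupp_in_sub S S' al : S' \subset S -> msupp_in S' al -> msupp_in S al.
Proof.
move=> sub /forallP al0; apply/forallP => j; apply/implyP => jS.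
by have /implyP := al0 j; apply; apply: contraNN jS => /(fintype.subsetP sub).
Qed.

Lemma is_faceT : is_face [set: _].
Proof. by move=> al be _ _; apply/forallP => j; rewrite inE. Qed.

(** Each fibre of [expo] lies in [S'] entirely or contains nothing supported there, so a coefficient
    for [S'] is either the one for [S] or 0. *)
Lemma toric_mor_face S S' f : is_face S' -> S' \subset S ->
  toric_mor S f = 0 -> toric_mor S' f = 0.
Proof.
move=> face sub /mpolyP f0; apply/mpolyP => m; rewrite mcoeff0 toric_mor_coef.
have [/existsP[j /andP[jS /eqP jm]]|no] :=
  boolP [exists j : 'I_(size (msupp f)), msupp_in S' (tnth (in_tuple (msupp f)) j)
     && (expo (tnth (in_tuple (msupp f)) j) == m)].
  rewrite -[RHS](mcoeff0 _ m) -f0 toric_mor_coef; apply: eq_bigl => al.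
  have [aE|] := eqVneq (expo al) m; last by rewrite !andbF.
  have alS : msupp_in S' al by apply: face jS; rewrite jm aE.
  by rewrite alS (msupp_in_sub sub alS).
rewrite big1_seq // => al /andP[alP alf]; case/negP: no.
have /tnthP[j jE] : al \in in_tuple (msupp f) by [].
by apply/existsP; exists j; rewrite -jE.
Qed.

Definition ratv m : 'rV[rat]_N := \row_i (m i)%:R.

Lemma ratvD m u : ratv (m + u)%MM = ratv m + ratv u.
Proof. by apply/rowP => i; rewrite !mxE mnmDE natrD. Qed.

Definition expo_mx : 'M[rat]_(mu, N) := \matrix_(j < mu) ratv (e j).

Lemma ratv_expo al : ratv (expo al) = (\row_j (al j)%:R) *m expo_mx.
Proof.
apply/rowP => i; rewrite !mxE expoE natr_sum; apply: eq_bigr => j _.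
by rewrite !mxE natrM mulrC.
Qed.

Section Faces.

Let L (l : 'cV[rat]_N) j : rat := (ratv (e j) *m l) 0 0.
Let rk S := \rank (rows_mx (fun j => ratv (e j)) (enum S)).

(** [l] takes equal values on both sides of a relation; if the value is 0, every term of the
    nonnegative sum vanishes. *)
Lemma functional_face S l : is_face S -> (forall j, j \in S -> 0 <= L l j) ->
  is_face [set j in S | L l j == 0].
Proof.
move=> face l_ge0 al be E alS.
have Lsum ga : (ratv (expo ga) *m l) 0 0 = \sum_j (ga j)%:R * L l j.
  rewrite ratv_expo -mulmxA !mxE; apply: eq_bigr => j _; rewrite mxE; congr (_ * _).
  by rewrite /L !mxE; apply: eq_bigr => i _; rewrite !mxE.
have sub : [set j in S | L l j == 0] \subset S.
  by apply/fintype.subsetP => j; rewrite inE => /andP[].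
have beS := face _ _ E (msupp_in_sub sub alS).
have: \sum_j (be j)%:R * L l j = 0.
  rewrite -Lsum -E Lsum big1 // => j _; have /forallP/(_ j)/implyP := alS.
  rewrite !inE; case: (j \in S) => /=; last by move/(_ isT)/eqP->; rewrite mul0r.
  by have [->|_ /(_ isT)/eqP->] := eqVneq (L l j) 0; rewrite ?mulr0 ?mul0r.
move/eqP; rewrite psumr_eq0 => [|j _]; last first.
  have [jS|jS] := boolP (j \in S); first by rewrite mulr_ge0 ?l_ge0.
  by have /forallP/(_ j)/implyP/(_ jS)/eqP-> := beS; rewrite mul0r.
move/allP => be0; apply/forallP => j; apply/implyP; rewrite inE.
have := be0 j (mem_index_enum _); rewrite /= mulf_eq0 pnatr_eq0 => /orP[->//|->].
by rewrite andbT => jS; have /forallP/(_ j)/implyP/(_ jS) := beS.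
Qed.

Hypothesis pointed : exists w, forall j, 0 < L w j.

(* Tilt a nonnegative functional l within the annihilator of its zero set until
   it vanishes at one more generator; the generator p prevents l from becoming 0. *)
Lemma facet S : S != finset.set0 -> is_face S ->
  exists S', [/\ is_face S', S' \proper S & rk S <= (rk S').+1]%N.
Proof.
move=> S0 face; pose Z l := [set j in S | L l j == 0].
pose nice l := (forall j, j \in S -> 0 <= L l j) /\ exists2 p, p \in S & 0 < L l p.
suff [l [[l_ge0 [p pS lp]] rkl]] : exists l, nice l /\ (rk S <= (rk (Z l)).+1)%N.
  exists (Z l); split=> //; first exact: functional_face.
  rewrite properE; apply/andP; split; first by apply/fintype.subsetP => j; rewrite inE => /andP[].
  by apply/fintype.subsetPn; exists p; rewrite // inE pS gt_eqF.
have [w w_gt0] := pointed.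
have: nice w.
  split=> [j _|]; first exact: ltW.
  by have /finset.set0Pn[p pS] := S0; exists p.
have [q] := ubnP (rk S - rk (Z w)); elim: q w {w_gt0} => // q IHq l lt_q nice_l.
have [le|gt] := leqP (rk S) (rk (Z l)).+1; first by exists l.
case: (nice_l) => l_ge0 [p pS lp].
(* [W] has smaller rank than [S], so a column of its cokernel gives an [l'] that vanishes on [Z l]
   and at [p] and, up to sign, is negative somewhere on [S]. *)
pose W := rows_mx (fun j => ratv (e j)) (p :: enum (Z l)).
have rkW : (\rank W <= (rk (Z l)).+1)%N by apply: rank_rows_mx_cons.
have [j jS [c jc]] : exists2 j, j \in S & exists c, (ratv (e j) *m cokermx W) 0 c != 0.
  have : ~~ (rows_mx (fun j => ratv (e j)) (enum S) <= W)%MS.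
    by apply/negP => /mxrankS/leq_trans/(_ rkW); rewrite leqNgt gt.
  move=> H; have /existsP[j /andP[jS jW]] : [exists j in S, ~~ (ratv (e j) <= W)%MS].
    apply: contraNT H => /existsPn H; apply/rows_mx_subP => j; rewrite mem_enum => jS.
    by have := H j; rewrite jS negbK.
  exists j => //; rewrite submxE in jW.
  have /existsP[c jc] : [exists c, (ratv (e j) *m cokermx W) 0 c != 0].
    apply: contraNT jW => /existsPn jW; apply/eqP/rowP => c; rewrite [RHS]mxE.
    by have := jW c; rewrite negbK => /eqP.
  by exists c.
have [l' [l'W [i iS li]]] : exists l', (forall i, (ratv (e i) <= W)%MS -> L l' i = 0) /\
    exists2 i, i \in S & L l' i < 0.
  pose l0 := col c (cokermx W).
  have L0 i : L l0 i = (ratv (e i) *m cokermx W) 0 c.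
    by rewrite /L !mxE; apply: eq_bigr => z _; rewrite !mxE.
  have L0W i : (ratv (e i) <= W)%MS -> L l0 i = 0.
    by rewrite submxE L0 => /eqP->; rewrite mxE.
  move: jc; rewrite -L0 neq_lt => /orP[lt0|gt0].
    by exists l0; split=> //; exists j.
  have LN i : L (- l0) i = - L l0 i by rewrite /L mulmxN mxE.
  exists (- l0); split=> [i /L0W|]; first by rewrite LN => ->; rewrite oppr0.
  by exists j; rewrite // LN oppr_lt0.
(* Minimum ratio test: [t] is the largest value for which l + t l' stays nonnegative on [S], and it
   creates a zero at [i0]. *)
pose ratio i := L l i / - L l' i.
have Pi : (i \in S) && (L l' i < 0) by rewrite iS.
case: (@arg_minP _ _ _ i (fun i => (i \in S) && (L l' i < 0)) ratio Pi).
move=> i0 /andP[i0S li0] i0min; set t := ratio i0.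
have t_ge0 : 0 <= t by rewrite divr_ge0 ?l_ge0 // oppr_ge0 ltW.
pose l2 := l + t *: l'.
have L2 j' : L l2 j' = L l j' + t * L l' j'.
  by rewrite /L mulmxDr -scalemxAr !mxE.
have l'Z i' : i' \in Z l -> L l' i' = 0.
  by move=> iZ; apply/l'W/rows_mx_mem; rewrite inE mem_enum iZ orbT.
have L2i0 : L l2 i0 = 0.
  by rewrite L2 /t /ratio invrN mulrN mulNr divfK ?subrr // lt_eqF.
have Zl2 : Z l \subset Z l2.
  apply/fintype.subsetP => j' jZ; move: (jZ); rewrite !inE => /andP[-> /eqP jl].
  by rewrite L2 jl l'Z // mulr0 addr0 eqxx.
have nice2 : nice l2.
  split=> [j' j'S|]; last first.
    exists p => //; rewrite L2 l'W ?mulr0 ?addr0 //.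
    by apply: rows_mx_mem; rewrite mem_head.
  rewrite L2; have [ge0|lt0] := leP 0 (L l' j').
    by rewrite addr_ge0 ?l_ge0 // mulr_ge0.
  have := i0min j'; rewrite j'S lt0 => /(_ isT).
  by rewrite /ratio ler_pdivlMr ?oppr_gt0 // mulrN -subr_ge0 opprK.
(* [i0] is outside the span of [Z l]: otherwise [l] would vanish at [i0], placing it in [Z l], where
   [l'] vanishes too. *)
have rk2 : (rk (Z l) < rk (Z l2))%N.
  have sub : (rows_mx (fun j => ratv (e j)) (enum (Z l)) <=
      rows_mx (fun j => ratv (e j)) (enum (Z l2)))%MS.
    by apply: rows_mx_sub => j'; rewrite !mem_enum; apply: (fintype.subsetP Zl2).
  rewrite ltn_neqAle (mxrankS sub) andbT (mxrank_leqif_sup sub).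
  apply/negP => /rows_mx_subP/(_ i0); rewrite mem_enum inE i0S L2i0 eqxx => /(_ isT).
  case/submxP => D iD; have: i0 \in Z l.
    rewrite inE i0S /L iD -mulmxA.
    suff -> : rows_mx (fun j => ratv (e j)) (enum (Z l)) *m l = 0.
      by rewrite mulmx0 mxE eqxx.
    apply/row_matrixP => r; rewrite row_mul rowK row0; apply/rowP => z.
    rewrite ord1 [RHS]mxE; have := mem_tnth r (in_tuple (enum (Z l))).
    by rewrite mem_enum inE => /andP[_ /eqP].
  by move/l'Z/eqP; rewrite lt_eqF.
by apply: (IHq l2) => //; lia.
Qed.

(** Passing to a facet loses at most one in rank, so iteration takes at least [rk S] strict steps;
    the recursion is on the cardinality of [S]. *)
Lemma face_chain S : is_face S -> exists F : nat -> {set 'I_mu},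
  [/\ F 0%N = S, forall i, (i <= rk S)%N -> is_face (F i) &
      forall i, (i < rk S)%N -> F i.+1 \proper F i].
Proof.
have [q] := ubnP #|S|; elim: q S => // q IHq S lt_q face.
have [SE|S0] := eqVneq S finset.set0.
  have r0 : rk finset.set0 = 0%N.
    by apply/eqP; rewrite -leqn0; apply: leq_trans (rank_leq_row _) _; rewrite enum_set0.
  by exists (fun=> S); split=> // i; rewrite SE r0.
have [S' [face' sub rkS]] := facet S0 face.
have [|F [F0 Fface Fprop]] := IHq S' _ face'.
  by apply: leq_trans (proper_card sub) _; rewrite -ltnS.
exists (fun i => if i is j.+1 then F j else S); split=> // -[|i] ir //.
- by apply: Fface; lia.
- by rewrite F0.
- by apply: Fprop; lia.
Qed.

End Faces.
End Toric.

(** * Chains of primes in a toric ring *)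

Section ToricKrullDimension.
Variables (k : fieldType) (mu N : nat) (e : 'I_mu -> 'X_{1..N}).
Variables (A : comNzRingType) (rho : {rmorphism {mpoly k[mu]} -> A}).
Local Notation theta := (toric_mor k e).
(** [A] enters through a presentation with the kernel of the toric map, which is the form in which
    the fiber cone arises; no toric subring is built. *)
Hypothesis rho_surj : forall z, exists f, rho f = z.
Hypothesis rho_ker : forall f, rho f = 0 <-> theta [set: _] f = 0.
Hypothesis pointed : exists w : 'cV[rat]_N, forall j, 0 < (ratv (e j) *m w) 0 0.

Definition face_ideal (S : {set 'I_mu}) : {pred A} :=
  fun z => `[< exists2 f, rho f = z & theta S f = 0 >].

(** Two preimages of one element differ by an element of the toric kernel, which a face sends to 0;
    so any preimage decides membership. *)
Lemma face_idealP S f : is_face e S ->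
  reflect (theta S f = 0) (rho f \in face_ideal S).
Proof.
move=> face; apply: (iffP (asboolP _)) => [[g gf g0]|]; last by exists f.
apply/eqP; rewrite -[f](subrK g) rmorphD g0 addr0; apply/eqP.
apply: (toric_mor_face face (finset.subsetT S)).
by apply/rho_ker; rewrite rmorphB gf subrr.
Qed.

(** Modulo this ideal the ring embeds into a polynomial ring, which is a domain. *)
Lemma face_ideal_prime S : is_face e S -> is_prime_ideal (face_ideal S).
Proof.
move=> face; split; first split.
- by rewrite -(rmorph0 rho); apply/face_idealP => //; rewrite rmorph0.
- by rewrite -(rmorph1 rho); apply/face_idealP => //; rewrite rmorph1; apply/eqP/oner_neq0.
- move=> a u v; have [a' <-] := rho_surj a; have [u' <-] := rho_surj u.
  have [v' <-] := rho_surj v.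
  move=> /(face_idealP _ face) u0 /(face_idealP _ face) v0; rewrite -rmorphM -rmorphD.
  by apply/face_idealP => //; rewrite rmorphD rmorphM u0 // v0 // mulr0 addr0.
move=> u v; have [u' <-] := rho_surj u; have [v' <-] := rho_surj v.
rewrite -rmorphM => /(face_idealP _ face); rewrite rmorphM => /eqP.
rewrite mulf_eq0 => /orP[]/eqP uv; apply/orP; [left|right]; exact/face_idealP.
Qed.

(** Descending faces give ascending primes; a variable whose index lies in the larger face only
    makes the inclusion strict. *)
Lemma toric_prime_chain : exists P : nat -> {pred A}, prime_chain (\rank (expo_mx e)) P.
Proof.
have [F [F0 Fface Fprop]] := face_chain pointed (@is_faceT _ _ e).
set rk := \rank _ in Fface Fprop.
have rkE : (\rank (expo_mx e) <= rk)%N.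
  apply/mxrankS/row_subP => j; rewrite rowK.
  by apply: (rows_mx_mem (fun j => ratv (e j))); rewrite mem_enum inE.
exists (fun i => face_ideal (F i)); split=> i /leq_trans/(_ rkE) ir.
  exact/face_ideal_prime/Fface.
have face := Fface _ (ltnW ir); have face' := Fface _ ir.
have /andP[/[dup] sub _ /fintype.subsetPn[j jF jF']] := Fprop _ ir; split=> [z|].
  have [f <-] := rho_surj z => /(face_idealP _ face) f0; apply/face_idealP => //.
  by apply: toric_mor_face face' sub f0.
have in1 S : msupp_in S U_(j)%MM = (j \in S).
  apply/forallP/idP => [/(_ j)|jS i']; rewrite mnm1E ?eqxx; first by case: (j \in S).
  by have [<-|] := eqVneq j i'; rewrite ?jS ?implybT.
have Xj' : rho 'X_j \in face_ideal (F i.+1).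
  by apply/face_idealP => //; rewrite toric_morX in1 (negbTE jF').
move=> /(_ _ Xj')/(face_idealP _ face); rewrite toric_morX in1 jF.
move=> /mpolyP/(_ (expo e U_(j)%MM)); rewrite mcoeffX eqxx mcoeff0 => /eqP.
by rewrite oner_eq0.
Qed.

(** Coordinates that determine the whole exponent have the same fibres, hence the same coefficient
    sums. This replaces [N] variables by [r]. *)
Lemma toric_mor_proj r (s : 'I_r -> 'I_N) f :
    (forall al be, (forall i, expo e al (s i) = expo e be (s i)) ->
      expo e al = expo e be) ->
  toric_mor k (fun j => [multinom e j (s i) | i < r]) [set: _] f = 0 ->
  theta [set: _] f = 0.
Proof.
set e' := (fun j => [multinom e j (s i) | i < r]) => inj f0.
 have e'E al i : expo e' al i = expo e al (s i).
  by rewrite !expoE; apply: eq_bigr => j _; rewrite mnmE.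
apply/mpolyP => m; rewrite mcoeff0 toric_mor_coef.
have [/hasP[al _ /eqP am] | /hasPn no] := boolP (has (fun al => expo e al == m) (msupp f)).
  rewrite -[RHS](mcoeff0 _ (expo e' al)) -f0 toric_mor_coef; apply: eq_bigl => be.
  congr (_ && _); rewrite -am; apply/eqP/eqP => [E|/mnmP E].
    by apply/mnmP => i; rewrite !e'E E.
  by apply: inj => i; rewrite -!e'E.
by rewrite big1_seq // => al /andP[/andP[_ am] alf]; have := no al alf; rewrite am.
Qed.

Lemma toric_prime_chain_le d (P : nat -> {pred A}) :
  prime_chain d P -> (d <= \rank (expo_mx e))%N.
Proof.
move=> [Pprime Pchain]; rewrite -mxrank_tr leqNgt; apply/negP.
set M := (expo_mx e)^T; set r := \rank M => rd.
(* [s] picks [r] coordinates of which all others are linear combinations, so they determine the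
   exponent. *)
pose s := maxrankfun M; pose e' j := [multinom e j (s i) | i < r].
have ker f : toric_mor k e' [set: _] f = 0 -> rho f = 0.
  move=> f0; apply/rho_ker; apply: toric_mor_proj f0 => al be E.
  suff: ratv (expo e al) = ratv (expo e be).
    move/rowP => R; apply/mnmP => i; have := R i; rewrite !mxE => /eqP.
    by rewrite eqr_nat => /eqP.
  have /submxP[D MD] : (M <= rowsub s M)%MS by rewrite eq_maxrowsub.
  have : expo_mx e = colsub s (expo_mx e) *m D^T.
    by rewrite -[LHS]trmxK -/M {1}MD trmx_mul; congr (_ *m _); apply/matrixP => i j; rewrite !mxE.
  rewrite !ratv_expo => ->; rewrite !mulmxA; congr (_ *m _).
  have cs (ga : 'X_{1..mu}) i :
      ((\row_j (ga j)%:R) *m colsub s (expo_mx e)) 0 i = (expo e ga (s i))%:R.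
    have <- : ratv (expo e ga) 0 (s i) = (expo e ga (s i))%:R by rewrite mxE.
    by rewrite ratv_expo !mxE; apply: eq_bigr => j _; rewrite !mxE.
  by apply/rowP => i; rewrite !cs E.
(* [x i] witnesses strictness of the i-th inclusion; the default 0 is never taken for i <= r. *)
pose x i := xget 0 [set z | z \in P i.+1 /\ z \notin P i].
have xP i : (i < r.+1)%N -> x i \in P i.+1 /\ x i \notin P i.
  move=> ir; have [_ nsub] := Pchain i (leq_trans ir rd).
  apply: (@xgetPex _ 0 [set z | z \in P i.+1 /\ z \notin P i]).
  apply: contrapT => no; apply: nsub => z zP; apply: contrapT => /negP zN.
  by apply: no; exists z.
have [g gx] : exists g : 'I_r.+1 -> {mpoly k[mu]}, forall i, rho (g i) = x i.
  have H i : {g | rho g = x i} by apply/cid/rho_surj.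
  by exists (fun i => sval (H i)) => i; case: (H i).
have [m [c [/existsP[y0 cy0] rel]]] :=
  mpoly_algebraic_dependence (fun i => toric_mor k e' [set: _] (g i)).
pose ss := [seq y <- enum {ffun 'I_r.+1 -> 'I_m} | c y != 0].
pose E (y : {ffun 'I_r.+1 -> 'I_m}) := [seq (y i : nat) | i <- enum 'I_r.+1].
have Enth y (i : 'I_r.+1) : nth 0%N (E y) i = y i.
  by rewrite (nth_map i) ?size_enum_ord // nth_ord_enum.
have chain : prime_chain r.+1 P.
  by split=> i ir; [apply: Pprime|apply: Pchain]; apply: leq_trans ir rd.
have := @prime_chain_independent A k (rho \o @mpolyC mu k) r.+1 P x _ ss c E chain xP.
suff -> : \sum_(t <- ss) (rho \o @mpolyC mu k) (c t) * \prod_(i < r.+1) x i ^+ nth 0%N (E t) i = 0.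
  rewrite prime_ideal0; last exact: Pprime.
  move=> H; suff: ~~ true by []; apply: H.
  - by apply/eqP => ss0; have: y0 \in ss; [rewrite mem_filter cy0 mem_enum | rewrite ss0].
  - rewrite map_inj_uniq; first exact/filter_uniq/enum_uniq.
    move=> y z yz.
    by apply/ffunP => i; apply: val_inj; rewrite /= -!Enth yz.
  - by move=> y; rewrite mem_filter => /andP[].
  - by move=> y _; rewrite size_map size_enum_ord.
(* The relation among the images in [r] variables lifts to a polynomial killed by the projected map,
   hence by [rho]. *)
have := ker (\sum_y c y *: \prod_i g i ^+ y i); rewrite !rmorph_sum /=.
have -> : \sum_i toric_mor k e' [set: _] (c i *: \prod_i0 g i0 ^+ i i0) = 0.
  rewrite -[RHS]rel; apply: eq_bigr => y _; rewrite -!mul_mpolyC rmorphM rmorph_prod.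
  rewrite /toric_mor /= mmapC; congr (_ * _); apply: eq_bigr => i _; exact: rmorphXn.
move/(_ erefl) => rel0; rewrite -[RHS]rel0 /ss big_filter big_enum_cond big_mkcond /=.
apply: eq_bigr => y _; case: ifP => [_|/negbFE/eqP->]; last by rewrite scale0r rmorph0.
rewrite -mul_mpolyC rmorphM rmorph_prod; congr (_ * _); apply: eq_bigr => i _.
by rewrite rmorphXn Enth gx.
Qed.

Theorem toric_krull_dim : krull_dim_is A (\rank (expo_mx e)).
Proof. by split; [apply: toric_prime_chain|apply: toric_prime_chain_le]. Qed.

End ToricKrullDimension.

(** * The fiber cone of an equigenerated monomial ideal *)

Local Open Scope quotient_scope.

Section Augmentation.
Variable n : nat.
Implicit Types m u : 'X_{1..n}.

(* The exponent of x^m t^i; coordinate 0 is the exponent of t. *)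
Definition augd i m : 'X_{1..n.+1} := [multinom oapp m i (unlift ord0 j) | j < n.+1].

Lemma augd0E i m : augd i m ord0 = i.
Proof. by rewrite mnmE unlift_none. Qed.

Lemma augdSE i m j : augd i m (lift ord0 j) = m j.
Proof. by rewrite mnmE liftK. Qed.

Lemma augd_inj i i' m m' : augd i m = augd i' m' -> i = i' /\ m = m'.
Proof.
move=> /mnmP E; split; first by have := E ord0; rewrite !augd0E.
by apply/mnmP => j; have := E (lift ord0 j); rewrite !augdSE.
Qed.

Lemma augdD i i' m m' : (augd i m + augd i' m' = augd (i + i') (m + m'))%MM.
Proof.
by apply/mnmP => j; rewrite mnmDE; case: (unliftP ord0 j) => [j' ->|->];
  rewrite ?augd0E // !augdSE mnmDE.
Qed.

Lemma augd_surj (M : 'X_{1..n.+1}) : exists i m, M = augd i m.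
Proof.
exists (M ord0), [multinom M (lift ord0 j) | j < n]; apply/mnmP => j.
by case: (unliftP ord0 j) => [j' ->|->]; rewrite ?augd0E // augdSE mnmE.
Qed.

(** With coordinate 0 equal to 1, linear independence of these vectors is affine independence of the
    exponents. *)
Definition augv m : 'rV[rat]_n.+1 := ratv (augd 1 m).

Lemma augv_hom m1 m2 m3 m4 : (m1 + m2 = m3 + m4)%MM ->
  augv m1 + augv m2 = augv m3 + augv m4.
Proof. by move=> E; rewrite /augv -!ratvD !augdD E. Qed.

End Augmentation.

Section FiberCone.
Variables (k : fieldType) (n : nat) (s : seq 'X_{1..n}).
Local Notation R := {mpoly k[n]}.
Local Notation I := (monomial_gen s : set R).
Local Notation mu := (size s).
Local Notation gen j := (tnth (in_tuple s) j).
Local Notation e := (fun j : 'I_mu => augd 1 (gen j)).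
Local Notation pi := (\pi_({ideal_quot (@fiber_pred k n I)})).

Definition rees_const (c : k) : rees I := Rees (rees_const_subproof I c).

Lemma rees_const_is_zmod_morphism : zmod_morphism rees_const.
Proof. by move=> x y; apply: val_inj; rewrite /= raddfB /= !raddfB. Qed.

Lemma rees_const_is_monoid_morphism : monoid_morphism rees_const.
Proof.
split; first by apply: val_inj; rewrite /= !rmorph1.
by move=> x y; apply: val_inj; rewrite /= !rmorphM.
Qed.

HB.instance Definition _ :=
  GRing.isZmodMorphism.Build k (rees I) rees_const rees_const_is_zmod_morphism.
HB.instance Definition _ :=
  GRing.isMonoidMorphism.Build k (rees I) rees_const rees_const_is_monoid_morphism.

Lemma rees_var_subproof (j : 'I_mu) : ('X_[gen j] : R) *: 'X \in rees_pred I.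
Proof.
apply/rees_predP => i; rewrite coefZ coefX; case: i => [//|[|i]] /=.
  rewrite mulr1 ideal_mulT; apply/monomial_genX.
  by exists (gen j); [apply: mem_tnth|apply: lepm_refl].
by rewrite mulr0; apply: ideal_gen0.
Qed.

(** The j-th variable goes to x^c t for the j-th generator [c]. Coefficients come from k only, so
    the image is the candidate copy of F(I) inside the Rees algebra. *)
Definition rees_lift : {rmorphism {mpoly k[mu]} -> rees I} :=
  mmap rees_const (fun j => Rees (rees_var_subproof j)).

Definition fiber_lift : {rmorphism {mpoly k[mu]} -> fiber_cone I} := pi \o rees_lift.

Lemma fiber_liftC c : fiber_lift c%:MP = fiber_const I c.
Proof. by rewrite /fiber_lift /= mmapC. Qed.

Lemma val_rees_liftM f g :
  val (rees_lift (f * g)) = val (rees_lift f) * val (rees_lift g).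
Proof. by rewrite !rmorphM. Qed.

Lemma val_rees_liftC c : val (rees_lift c%:MP) = c%:MP%:P.
Proof. by rewrite /rees_lift /= mmapC. Qed.

Definition gexpo (al : 'X_{1..mu}) : 'X_{1..n} := (\sum_j gen j *+ al j)%MM.

Lemma expo_augd al : expo e al = augd (mdeg al) (gexpo al).
Proof.
apply/mnmP => i; rewrite expoE; case: (unliftP ord0 i) => [i' ->|->].
  rewrite augdSE /gexpo mnm_sumE; apply: eq_bigr => j _.
  by rewrite augdSE mulmnE.
by rewrite augd0E mdegE; apply: eq_bigr => j _; rewrite augd0E mul1n.
Qed.

Lemma val_rees_liftX al :
  val (rees_lift 'X_[al]) = ('X_[gexpo al] : R) *: 'X^(mdeg al).
Proof.
have -> : rees_lift 'X_[al] = \prod_j Rees (rees_var_subproof j) ^+ al j.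
  by rewrite /rees_lift /= mmapX.
rewrite rmorph_prod /gexpo mdegE -mprodXnE -prodrXr -scaler_prod.
by apply: eq_bigr => j _; rewrite rmorphXn -exprZn.
Qed.

Lemma val_rees_lift_coef f i m : ((val (rees_lift f))`_i)@_m =
  \sum_(al <- msupp f | expo e al == augd i m) f@_al.
Proof.
rewrite {1}[f]mpolyE (raddf_sum rees_lift) (raddf_sum (val : rees I -> {poly R})).
rewrite coef_sum raddf_sum [RHS]big_mkcond.
apply: eq_bigr => al _.
have E : val (rees_lift (f@_al *: 'X_[al])) =
    (f@_al)%:MP%:P * ('X_[gexpo al] *: 'X^(mdeg al)) :> {poly R}.
  by rewrite -val_rees_liftX -mul_mpolyC val_rees_liftM val_rees_liftC.
transitivity (((f@_al)%:MP%:P * (('X_[gexpo al] : R) *: 'X^(mdeg al)))`_i@_m).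
  by rewrite -E.
rewrite coefCM coefZ coefXn mcoeffCM expo_augd.
have -> : (augd (mdeg al) (gexpo al) == augd i m) = (i == mdeg al) && (gexpo al == m).
  by apply/eqP/andP => [/augd_inj[-> ->]|[/eqP-> /eqP->]].
case: eqP => _ /=; last by rewrite mulr0 mcoeff0 mulr0.
by rewrite mulr1 mcoeffX; case: eqP; rewrite ?mulr1 ?mulr0.
Qed.

(** With [t] read as the extra variable 0, both maps send a monomial to the same exponent. *)
Lemma rees_lift_eq0 f : val (rees_lift f) = 0 <-> toric_mor k e [set: _] f = 0.
Proof.
have E i m : (toric_mor k e [set: _] f)@_(augd i m) = ((val (rees_lift f))`_i)@_m.
  rewrite val_rees_lift_coef toric_mor_coef; apply: eq_bigl => al.
  by rewrite (_ : msupp_in _ _) //; apply/forallP => j; rewrite inE.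
split=> [f0|/mpolyP f0].
  by apply/mpolyP => M; have [i [m ->]] := augd_surj M; rewrite E f0 coef0 !mcoeff0.
by apply/polyP => i; apply/mpolyP => m; rewrite -E f0 coef0 !mcoeff0.
Qed.

Local Notation mI i := (ideal_mul (@max_ideal k n) (ideal_exp I i)).

Lemma max_idealP (p : R) : p@_0%MM = 0 -> max_ideal p.
Proof.
move=> p0; rewrite [p]mpolyE big_seq; apply: ideal_gen_sum => m mp.
have m0 : m != 0%MM by apply: contraTneq mp => ->; rewrite mcoeff_msupp p0 eqxx.
have /existsP[i mi] : [exists i, m i != 0%N].
  apply: contraNT m0 => /existsPn m0; apply/eqP/mnmP => i.
  by rewrite mnm0E; have := m0 i; rewrite negbK => /eqP.
rewrite -mul_mpolyC -(@submK _ U_(i) m) ?lep1mP // mpolyXD mulrA.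
by apply: ideal_genM; apply: ideal_gen_sub; exists i.
Qed.

Lemma mI_mul i j p q : mI i p -> ideal_exp I j q -> mI (i + j) (p * q).
Proof.
move=> mp Iq; move: p mp; apply: ideal_gen_ind => [|x y mx my|x _ [b [c [mb Ic ->]]]].
- by rewrite mul0r; apply: ideal_gen0.
- by rewrite mulrDl; apply: ideal_genD.
- rewrite -!mulrA; apply: ideal_genM; apply: ideal_gen_sub; exists b, (c * q).
  by split=> //; apply: ideal_exp_mul.
Qed.

Lemma mI_coef0 i p q : p@_0%MM = 0 -> ideal_exp I i q -> mI i (p * q).
Proof. by move=> /max_idealP mp Iq; apply: ideal_gen_sub; exists p, q. Qed.

(* g in I^i is congruent modulo m I^i to a combination h of products of i generators. *)
Definition liftable i (g : R) := exists f h,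
  [/\ val (rees_lift f) = h *: 'X^i, ideal_exp I i h & mI i (g - h)].

Lemma liftable0 i : liftable i 0.
Proof.
exists 0, 0; rewrite !raddf0 scale0r; split=> //; first exact: ideal_exp0.
by rewrite addr0; apply: ideal_gen0.
Qed.

Lemma liftableD i g g' : liftable i g -> liftable i g' -> liftable i (g + g').
Proof.
move=> [f [h [fh Ih gh]]] [f' [h' [fh' Ih' gh']]]; exists (f + f'), (h + h'); split.
- by rewrite !raddfD /= fh fh' scalerDl.
- exact: ideal_expD.
- by rewrite opprD addrACA; apply: ideal_genD.
Qed.

(** Replacing [x] by its constant term, [b] by [h] and [c] by [h'] changes the product only by
    elements of m I^(i+j). *)
Lemma liftableM i j x b c : ideal_exp I i b -> ideal_exp I j c ->
  liftable i b -> liftable j c -> liftable (i + j) (x * (b * c)).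
Proof.
move=> Ib Ic [f [h [fh Ih bh]]] [f' [h' [fh' Ih' ch']]].
exists ((x@_0%MM)%:MP * (f * f')), ((x@_0%MM)%:MP * (h * h')); split.
- rewrite !val_rees_liftM fh fh' val_rees_liftC mul_polyC.
  by rewrite -scalerAl -scalerAr !scalerA -exprD mulrA.
- by apply: ideal_expM; apply: ideal_exp_mul.
- have -> : x * (b * c) - (x@_0%MM)%:MP * (h * h') =
      (x - (x@_0%MM)%:MP) * (b * c) +
      (x@_0%MM)%:MP * ((b - h) * c + (c - h') * h) by ring.
  apply: ideal_genD.
    apply: mI_coef0; last exact: ideal_exp_mul.
    by rewrite mcoeffB mcoeffC eqxx mulr1 subrr.
  apply: ideal_genM; apply: ideal_genD; first exact: mI_mul.
  by rewrite addnC; apply: mI_mul.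
Qed.

Lemma liftable1 g : liftable 0 g.
Proof.
exists (g@_0%MM)%:MP, (g@_0%MM)%:MP; split=> //.
  by rewrite val_rees_liftC expr0 alg_polyC.
rewrite -[_ - _]mulr1; apply: mI_coef0 => //.
by rewrite mcoeffB mcoeffC eqxx mulr1 subrr.
Qed.

Lemma liftable_gen g : I g -> liftable 1 g.
Proof.
move: g; apply: ideal_gen_ind => [|x y|x _ [u us <-]]; first exact: liftable0.
  exact: liftableD.
have Iu : ideal_exp I 1 'X_[u].
  by rewrite /= ideal_mulT; apply: ideal_gen_sub; exists u.
rewrite -['X_[u]]mulr1; apply: (@liftableM 1 0) => //; last exact: liftable1.
have /tnthP[j ju] : u \in in_tuple s by [].
exists 'X_j, 'X_[u]; split=> //.
  by rewrite /rees_lift /= mmapX mmap1U /= -ju.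
by rewrite subrr; apply: ideal_gen0.
Qed.

Lemma ideal_exp_liftable i g : ideal_exp I i g -> liftable i g.
Proof.
elim: i g => [|i IHi] g; first by move=> _; apply: liftable1.
move: g; apply: ideal_gen_ind => [|x y|x _ [b [c [Ib Ic ->]]]]; first exact: liftable0.
  exact: liftableD.
apply: (@liftableM 1 i) => //; [by rewrite /= ideal_mulT|exact: liftable_gen|exact: IHi].
Qed.

(** The coefficients of a representative are lifted degree by degree; the sum of the lifts agrees
    with it modulo the m I^i. *)
Lemma fiber_lift_surj z : exists f, fiber_lift f = z.
Proof.
have Ip i : ideal_exp I i (val (repr z))`_i by have /rees_predP := valP (repr z).
have /choice[F /choice[h Fh]] : forall i, exists f h,
    [/\ val (rees_lift f) = h *: 'X^i, ideal_exp I i h & mI i ((val (repr z))`_i - h)].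
  by move=> i; apply: ideal_exp_liftable.
exists (\sum_(i < size (val (repr z))) F i).
rewrite -[RHS]reprK; apply/eqP; rewrite -Quotient.idealrBE.
apply/fiber_predP => i; set N := size (val (repr z)).
have E : (val (rees_lift (\sum_(j < N) F j) - repr z))`_i =
    \sum_(j < N) h j * (i == j)%:R - (val (repr z))`_i.
  rewrite raddfB coefB (raddf_sum rees_lift) (raddf_sum (val : rees I -> {poly R})) coef_sum.
  congr (_ - _); apply: eq_bigr => j _.
  by have [fh _ _] := Fh j; rewrite -coefXn -coefZ -fh.
suff : mI i (\sum_(j < N) h j * (i == j)%:R - (val (repr z))`_i). by rewrite -E.
have [lt_i|ge_i] := ltnP i N.
  rewrite (bigD1 (Ordinal lt_i)) //= big1 ?addr0 => [|j ji].
    have [_ _ hz] := Fh i; rewrite eqxx mulr1.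
    by rewrite -opprB -mulN1r; apply: ideal_genM.
  by move: ji; rewrite -val_eqE /= eq_sym => /negbTE->; rewrite mulr0.
rewrite nth_default // subr0 big1 => [|j _]; first exact: ideal_gen0.
by rewrite gtn_eqF ?mulr0 //; apply: leq_trans (ltn_ord j) ge_i.
Qed.

Variables (a : 'I_n -> nat) (d : nat).
Hypothesis a_gt0 : forall i, (0 < a i)%N.
Hypothesis wt_s : {in s, forall m, wt a m = d}.

Lemma ideal_exp_wt i p : ideal_exp I i p -> {in msupp p, forall m, i * d <= wt a m}%N.
Proof.
elim: i p => [//|i IHi] p.
move: p; apply: ideal_gen_ind => [m|x y Hx Hy m|x _ [b [c [/monomial_genP Ib /IHi Ic ->]]] m].
- by rewrite msupp0.
- by move/msuppD_le; rewrite mem_cat => /orP[/Hx|/Hy].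
- move/msuppM_le/allpairsP => [[m1 m2] /= [_ + ->]].
  move/msuppM_le/allpairsP => [[m3 m4] /= [/Ib[u /wt_s us um] /Ic cm ->]].
  by rewrite !wtD mulSn; have := wt_le a um; rewrite us; lia.
Qed.

(** I^i starts in weight i d, where a multiplier acts through its constant term; that term is 0 for
    elements of m. *)
Lemma mI_wt i p m : mI i p -> wt a m = (i * d)%N -> p@_m = 0.
Proof.
move=> mp wm; move: p mp; apply: ideal_gen_ind => [|x y x0 y0|x _ [b [c [mb Ic ->]]]].
- exact: mcoeff0.
- by rewrite mcoeffD x0 y0 addr0.
- rewrite mulrA (@mcoeffM_wt_min _ a a_gt0 _ (i * d)) //; last exact: ideal_exp_wt.
  by rewrite rmorphM /= (max_ideal_coef0 mb) mulr0 mul0r.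
Qed.

Lemma wt_gexpo al : wt a (gexpo al) = (mdeg al * d)%N.
Proof.
rewrite /wt mdegE /gexpo big_distrl /=.
under eq_bigr => i _ do rewrite mnm_sumE big_distrr.
rewrite exchange_big; apply: eq_bigr => j _.
rewrite -(wt_s (mem_tnth j (in_tuple s))) /wt big_distrr /=.
by apply: eq_bigr => i _; rewrite mulmnE mulnA mulnC.
Qed.

(** In degree [i] the image has only terms of weight i d, and m I^i has none; so the image meets the
    ideal of the quotient in 0. *)
Lemma fiber_lift_ker f : fiber_lift f = 0 <-> toric_mor k e [set: _] f = 0.
Proof.
rewrite -rees_lift_eq0; have -> : fiber_lift f = 0 <-> rees_lift f \in fiber_pred (I := I).
  rewrite -[rees_lift f]subr0 Quotient.idealrBE /fiber_lift /=.
  have -> : pi 0 = 0 := rmorph0 _.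
  by split=> [->//|/eqP].
split=> [/fiber_predP f0|f0]; last first.
  by apply/fiber_predP => i; rewrite f0 coef0; apply: ideal_gen0.
apply/polyP => i; apply/mpolyP => m; rewrite coef0 mcoeff0.
have [/eqP wm|wm] := boolP (wt a m == i * d)%N; first exact: mI_wt wm.
rewrite val_rees_lift_coef big1 // => al; rewrite expo_augd => /eqP/augd_inj[ai am].
by rewrite -am -ai wt_gexpo eqxx in wm.
Qed.

End FiberCone.

Lemma krull_dim_uniq (A : comNzRingType) d1 d2 :
  krull_dim_is A d1 -> krull_dim_is A d2 -> d1 = d2.
Proof.
move=> [[P1 H1] le1] [[P2 H2] le2]; apply/eqP.
by rewrite eqn_leq (le2 _ _ H1) (le1 _ _ H2).
Qed.

Lemma bij_rmorphism_inv (A B : nzRingType) (f : {rmorphism A -> B}) :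
  bijective f -> exists g : {rmorphism B -> A}, cancel f g /\ cancel g f.
Proof.
move=> [g fK gK].
pose gZ := GRing.isZmodMorphism.Build B A g (can2_zmod_morphism fK gK).
pose gM := GRing.isMonoidMorphism.Build B A g (can2_monoid_morphism fK gK).
pose g' : {rmorphism B -> A} := HB.pack g gZ gM.
by exists g'.
Qed.

(** Independent rows make [expo] injective, so distinct monomials of [f] cannot cancel. *)
Lemma toric_mor_inj (k : fieldType) mu N (e : 'I_mu -> 'X_{1..N}) (f : {mpoly k[mu]}) :
  row_free (expo_mx e) -> toric_mor k e [set: _] f = 0 -> f = 0.
Proof.
move=> free f0; apply/mpolyP => al; rewrite mcoeff0.
have inj be : expo e be = expo e al -> be = al.
  move=> E; have : ratv (expo e be) = ratv (expo e al) by rewrite E.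
  rewrite !ratv_expo => /(row_free_inj free)/rowP {}E.
  by apply/mnmP => j; have := E j; rewrite !mxE => /eqP; rewrite eqr_nat => /eqP.
have /mpolyP/(_ (expo e al)) := f0; rewrite toric_mor_coef mcoeff0 => <-.
have [alf|alf] := boolP (al \in msupp f); last first.
  rewrite big1_seq ?memN_msupp_eq0 // => be /andP[/andP[_ /eqP/inj->]].
  by rewrite (negbTE alf).
rewrite big_mkcond (bigD1_seq al) ?msupp_uniq //= eqxx andbT ifT; last first.
  by apply/forallP => j; rewrite inE.
rewrite big1 ?addr0 // => be /negbTE bal; case: ifP => // /andP[_ /eqP/inj].
by move/eqP; rewrite bal.
Qed.

(** A polynomial ring is the toric ring of the unit vectors, on which the coordinate sum is
    positive. *)
Lemma mpoly_iso_krull_dim (k : fieldType) m (A : comNzRingType)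
    (rho : {rmorphism {mpoly k[m]} -> A}) : bijective rho -> krull_dim_is A m.
Proof.
move=> [rho' rhoK rho'K]; pose e (j : 'I_m) := U_(j)%MM.
have mx1 : expo_mx e = 1%:M by apply/matrixP => i j; rewrite !mxE mnm1E.
have := @toric_krull_dim k m m e A rho; rewrite mx1 mxrank1; apply.
- by move=> z; exists (rho' z).
- move=> f; split=> [f0|f0]; first by rewrite -[f]rhoK f0 -(rmorph0 rho) rhoK rmorph0.
  by rewrite (toric_mor_inj _ f0) ?rmorph0 // mx1 row_free_unit unitmx1.
- exists (const_mx 1) => j; have -> : ratv (e j) = row j 1%:M by rewrite -mx1 rowK.
  by rewrite -row_mul mul1mx !mxE ltr01.
Qed.

(** * Freiman and linear type ideals in terms of ranks and cardinalities *)

Section FreimanNumbers.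
Variables (k : fieldType) (n : nat) (s : seq 'X_{1..n}).
Variables (a : 'I_n -> nat) (d : nat).
Hypothesis a_gt0 : forall i, (0 < a i)%N.
Hypothesis wt_s : {in s, forall m, wt a m = d}.
Hypothesis uniq_s : uniq s.
Local Notation I := (monomial_gen s : set {mpoly k[n]}).

Definition spread (t : seq 'X_{1..n}) := \rank (rows_mx (@augv n) t).

Let e (j : 'I_(size s)) := augd 1 (tnth (in_tuple s) j).

Let expo_mxE : \rank (expo_mx e) = spread s.
Proof. by []. Qed.

Let pointed : exists w : 'cV[rat]_n.+1, forall j, 0 < (ratv (e j) *m w) 0 0.
Proof.
exists (delta_mx ord0 0) => j; rewrite -colE !mxE augd0E; exact: ltr01.
Qed.

Lemma analytic_spread_spread : analytic_spread_is I (spread s).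
Proof.
rewrite -expo_mxE; apply: (toric_krull_dim (rho := fiber_lift k s)) => //.
  exact: fiber_lift_surj.
exact: (fiber_lift_ker a_gt0 wt_s).
Qed.

Lemma spread_le_size : (spread s <= size s)%N.
Proof. exact: rank_leq_row. Qed.

(** Krull dimension and mu are unique, and the sums of two generators again have one weight, so the
    three numbers are known. The binomial is moved across to avoid subtraction in [nat]. *)
Lemma freiman_numbers :
  freiman I <->
  (size (sumset s s) + 'C(spread s, 2) = spread s * size s)%N.
Proof.
have mu1 := mu_is_equigenerated k a_gt0 uniq_s wt_s.
have mu2 : mu_is (ideal_exp I 2) (size (sumset s s)).
  rewrite ideal_exp2_monomial; apply: (mu_is_equigenerated k a_gt0 (undup_uniq _)) => m.
  by case/sumsetP => [u [v [us vs ->]]]; rewrite wtD !wt_s.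
split=> [[_ [l [m1 [m2 [sl ml1 ml2 E]]]]]|E].
  have lE := krull_dim_uniq sl analytic_spread_spread.
  have m1E := mu_is_uniq ml1 mu1; have m2E := mu_is_uniq ml2 mu2.
  by subst l m1 m2; lia.
split; first by exists s; [apply: equigenerated_min uniq_s wt_s|exists a; split=> //; exists d].
exists (spread s), (size s), (size (sumset s s)); split=> //.
  exact: analytic_spread_spread.
lia.
Qed.

(** An isomorphism equates the Krull dimension with the number of variables; conversely full rank
    makes the surjection [fiber_lift] injective. *)
Lemma linear_type_numbers : linear_type I <-> spread s = size s.
Proof.
have mu1 := mu_is_equigenerated k a_gt0 uniq_s wt_s.
split=> [[m mum [f fbij]]|sp].
  rewrite -(mu_is_uniq mum mu1).
  have [g [fK gK]] := bij_rmorphism_inv fbij.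
  apply: krull_dim_uniq analytic_spread_spread _.
  by apply: (@mpoly_iso_krull_dim k m _ g); exists f.
have free : row_free (expo_mx e) by rewrite /row_free expo_mxE sp.
exists (size s) => //.
have inj : injective (fiber_lift k s).
  apply: raddf_inj => f /(fiber_lift_ker a_gt0 wt_s); exact: toric_mor_inj.
have [g fg] : exists g, cancel g (fiber_lift k s).
  have H z : {f | fiber_lift k s f = z} by apply/cid/fiber_lift_surj.
  by exists (fun z => sval (H z)) => z; case: (H z).
have gf : cancel (fiber_lift k s) g by move=> f; apply: inj; rewrite fg.
pose gZ := GRing.isZmodMorphism.Build _ _ g (can2_zmod_morphism gf fg).
pose gM := GRing.isMonoidMorphism.Build _ _ g (can2_monoid_morphism gf fg).
have gL : scalable g.
  move=> c z; apply: inj; rewrite fg -mul_mpolyC rmorphM fg fiber_liftC.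
  by [].
pose gS := GRing.isScalable.Build k (fiber_cone I) {mpoly k[size s]} *:%R g gL.
pose g' : {lrmorphism fiber_cone I -> {mpoly k[size s]}} := HB.pack g gZ gM gS.
by exists g'; exists (fiber_lift k s).
Qed.

Lemma spread_freiman_inequality :
  (spread s * size s <= size (sumset s s) + 'C(spread s, 2))%N.
Proof. exact: freiman_inequality (@augv_hom n) _ uniq_s. Qed.

End FreimanNumbers.

(** * Cover ideals of joins *)

Section Covers.
Variables (k : fieldType) (n : nat) (G : sgraph n).
Implicit Types (m u : 'X_{1..n}).

Definition is_cover m := forall i j, G i j -> (m i != 0%N) || (m j != 0%N).

Definition ones : 'X_{1..n} := [multinom 1%N | i < n].

Lemma onesE i : ones i = 1%N.
Proof. exact: mnmE. Qed.

Lemma ones_cover : is_cover ones.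
Proof. by move=> i j _; rewrite !onesE. Qed.

(** An edge has two distinct ends, so one of them survives the omission of a vertex. *)
Lemma ones_sub_cover i : is_cover (ones - U_(i))%MM.
Proof.
move=> u v Guv; rewrite !mnmBE !onesE !mnm1E.
case: (eqVneq i u) => [iu|//]; case: (eqVneq i v) => [iv|//].
by rewrite -iu -iv adj_irr in Guv.
Qed.

Lemma edge_idealP i j (f : {mpoly k[n]}) :
  ideal_gen [set 'X_i; 'X_j]%classic f <->
  {in msupp f, forall m, (m i != 0%N) || (m j != 0%N)}.
Proof.
have -> : [set 'X_i; 'X_j]%classic =
    [set 'X_[m] | m in [set` [:: U_(i)%MM; U_(j)%MM]]]%classic :> set {mpoly k[n]}.
  apply/seteqP; split=> [_ [->|->]|_ [m /= + <-]].
  - by exists U_(i)%MM; rewrite //= mem_head.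
  - by exists U_(j)%MM; rewrite //= inE mem_head orbT.
  - by rewrite !inE => /orP[] /eqP->; [left|right].
split=> [/monomial_genP H m /H[u]|H]; last apply/monomial_genP.
  by rewrite !inE => /orP[] /eqP->; rewrite lep1mP => ->; rewrite ?orbT.
move=> m /H /orP[mi|mj]; [exists U_(i)%MM|exists U_(j)%MM];
  by rewrite ?lep1mP // !inE eqxx ?orbT.
Qed.

Lemma cover_idealP (f : {mpoly k[n]}) :
  cover_ideal k G f <-> {in msupp f, forall m, is_cover m}.
Proof.
split=> [H m mf i j Gij|H i j Gij]; first by have /edge_idealP := H i j Gij; apply.
by apply/edge_idealP => m /H; apply.
Qed.

Lemma cover_ideal_monomialP (s : seq 'X_{1..n}) :
  cover_ideal k G = monomial_gen s <->
  forall m, is_cover m <-> exists2 u, u \in s & (u <= m)%MM.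
Proof.
split=> [E m|E]; last first.
  apply/seteqP; split=> f.
    by move/cover_idealP => fG; apply/monomial_genP => m /fG /E.
  by move/monomial_genP => fs; apply/cover_idealP => m /fs /E.
rewrite -(monomial_genX k) -E cover_idealP; split=> [mG u|]; last first.
  by apply; rewrite msuppX inE.
by rewrite msuppX inE => /eqP->.
Qed.

(** Some generator divides the product of all variables but one. The strict gap later separates the
    two kinds of generators of the join. *)
Lemma cover_gen_wt_lt (s : seq 'X_{1..n}) (a : 'I_n -> nat) (d : nat) :
  cover_ideal k G = monomial_gen s -> (forall i, 0 < a i)%N ->
  {in s, forall m, wt a m = d} -> (0 < n)%N -> (d < wt a ones)%N.
Proof.
move=> /cover_ideal_monomialP E a_gt0 wt_s n_gt0.
have /E[u us ule] := ones_sub_cover (Ordinal n_gt0).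
rewrite -(wt_s u us); apply: leq_ltn_trans (wt_le a ule) _.
have le1 : (U_(Ordinal n_gt0) <= ones)%MM by rewrite lep1mP onesE.
rewrite -{2}(submK le1) wtD -addn1 leq_add2l lt0n (wt_eq0 a_gt0).
by rewrite mnm1_eq0.
Qed.

End Covers.

Arguments ones {n}.

Lemma size_undup_map_eq (T : Type) (U W : eqType) (f : T -> U) (g : T -> W) (s : seq T) :
  (forall x y, f x = f y <-> g x = g y) ->
  size (undup (map f s)) = size (undup (map g s)).
Proof.
move=> fg; elim: s => //= x s IHs.
have -> : (f x \in map f s) = (g x \in map g s).
  elim: s {IHs} => //= y s IHs; rewrite !inE IHs; congr (_ || _).
  by apply/eqP/eqP => /fg.
by case: ifP => _ //=; rewrite IHs.
Qed.

Lemma rows_mx_span_ind (T : eqType) (F : fieldType) N (V : T -> 'rV[F]_N)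
    (s : seq T) (P : 'rV[F]_N -> Prop) :
  P 0 -> (forall a u v, P u -> P v -> P (a *: u + v)) ->
  {in s, forall m, P (V m)} -> forall x, (x <= rows_mx V s)%MS -> P x.
Proof.
move=> P0 PD PV x /submxP[D ->]; rewrite mulmx_sum_row.
apply: big_rec => // i y _ Py; apply: PD => //; rewrite rowK.
exact/PV/mem_tnth.
Qed.

(* phi pads exponents by coordinates equal to 1, the value of the augmenting coordinate *)
Section Padding.
Variables (n N : nat) (phi : 'X_{1..n} -> 'X_{1..N}).
Variables (h : 'I_N.+1 -> 'I_n.+1) (g : 'I_n.+1 -> 'I_N.+1).
Hypothesis hg : cancel g h.
Hypothesis phiE : forall u j, augd 1 (phi u) j = augd 1 u (h j).

Lemma padding_sum_inj u u' v v' :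
  (phi u + phi u' = phi v + phi v')%MM <-> (u + u' = v + v')%MM.
Proof.
split=> E.
  have: (augd 1 u + augd 1 u' = augd 1 v + augd 1 v')%MM.
    apply/mnmP => j; rewrite !mnmDE -(hg j) -!phiE.
    have : (augd 1 (phi u) + augd 1 (phi u') = augd 1 (phi v) + augd 1 (phi v'))%MM.
      by rewrite !augdD E.
    by move/mnmP/(_ (g j)); rewrite !mnmDE.
  by rewrite !augdD => /augd_inj[].
have: (augd 1 (phi u) + augd 1 (phi u') = augd 1 (phi v) + augd 1 (phi v'))%MM.
  apply/mnmP => j; rewrite !mnmDE !phiE.
  have : (augd 1 u + augd 1 u' = augd 1 v + augd 1 v')%MM by rewrite !augdD E.
  by move/mnmP/(_ (h j)); rewrite !mnmDE.
by rewrite !augdD => /augd_inj[].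
Qed.

(** The padded matrix consists of columns of the original chosen by [h], and [g] recovers the
    original; choosing columns never raises the rank. *)
Lemma spread_padding s : spread (map phi s) = spread s.
Proof.
rewrite /spread; set A := rows_mx _ s.
have -> : \rank (rows_mx (@augv N) (map phi s)) = \rank (colsub h A).
  have -> : colsub h A = rows_mx (@augv N \o phi) s.
    by apply/matrixP => i j; rewrite !mxE phiE.
  apply/eqP; rewrite eqn_leq; apply/andP; split; apply/mxrankS/rows_mx_subP.
    by move=> _ /mapP[u us ->]; apply: (rows_mx_mem (augv (n:=N) \o phi)).
  by move=> u us; apply/rows_mx_mem/map_f.
have rk q p p' (B : 'M[rat]_(q, p)) (f : 'I_p' -> 'I_p) : (\rank (colsub f B) <= \rank B)%N.
  rewrite -mxrank_tr -[leqRHS]mxrank_tr.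
  have -> : (colsub f B)^T = rowsub f B^T by apply/matrixP => i j; rewrite !mxE.
  exact/mxrankS/rowsub_sub.
apply/eqP; rewrite eqn_leq rk /=.
have {1}-> : A = colsub g (colsub h A) by apply/matrixP => i j; rewrite !mxE hg.
exact: rk.
Qed.

Lemma size_sumset_padding s :
  size (sumset (map phi s) (map phi s)) = size (sumset s s).
Proof.
rewrite /sumset allpairs_mapl allpairs_mapr.
have E (T : Type) (f : 'X_{1..n} -> 'X_{1..n} -> T) :
    [seq f x y | x <- s, y <- s] = map (fun p => f p.1 p.2) [seq (x, y) | x <- s, y <- s].
  by rewrite map_allpairs.
rewrite (E _ (fun x y => phi x + phi y)%MM) (E _ (fun x y => x + y)%MM).
by apply: size_undup_map_eq => -[x x'] [y y'] /=; apply: padding_sum_inj.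
Qed.

End Padding.

(** * Exponents on the disjoint union of the vertex sets *)

Section Concatenation.
Variables n1 n2 : nat.
Implicit Types (u : 'X_{1..n1}) (v : 'X_{1..n2}).

Definition fcat (f : 'I_n1 -> nat) (g : 'I_n2 -> nat) (i : 'I_(n1 + n2)) :=
  match split i with inl x => f x | inr y => g y end.

Definition mcat u v : 'X_{1..n1 + n2} := [multinom fcat u v i | i < n1 + n2].

Lemma fcatL f g x : fcat f g (lshift n2 x) = f x.
Proof. by rewrite /fcat (unsplitK (inl x)). Qed.

Lemma fcatR f g y : fcat f g (rshift n1 y) = g y.
Proof. by rewrite /fcat (unsplitK (inr y)). Qed.

Lemma mcatL u v x : mcat u v (lshift n2 x) = u x.
Proof. by rewrite mnmE fcatL. Qed.

Lemma mcatR u v y : mcat u v (rshift n1 y) = v y.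
Proof. by rewrite mnmE fcatR. Qed.

Lemma mcat_surj (m : 'X_{1..n1 + n2}) : exists u v, m = mcat u v.
Proof.
exists [multinom m (lshift n2 x) | x < n1], [multinom m (rshift n1 y) | y < n2].
by apply/mnmP => i; rewrite mnmE; case: (split_ordP i) => j ->; rewrite ?fcatL ?fcatR mnmE.
Qed.

Lemma mcat_le u v u' v' : (mcat u v <= mcat u' v')%MM = (u <= u')%MM && (v <= v')%MM.
Proof.
apply/mnm_lepP/andP => [le|[/mnm_lepP le1 /mnm_lepP le2] i].
  split; apply/mnm_lepP => i; first by have := le (lshift n2 i); rewrite !mcatL.
  by have := le (rshift n1 i); rewrite !mcatR.
by rewrite !mnmE; case: (split_ordP i) => j ->; rewrite ?fcatL ?fcatR.
Qed.

Lemma mcatD u v u' v' : (mcat u v + mcat u' v' = mcat (u + u') (v + v'))%MM.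
Proof.
apply/mnmP => i; rewrite mnmDE !mnmE.
by case: (split_ordP i) => j ->; rewrite ?fcatL ?fcatR mnmDE.
Qed.

Lemma mcat_inj u v u' v' : mcat u v = mcat u' v' -> u = u' /\ v = v'.
Proof.
move=> /mnmP E; split; apply/mnmP => i.
  by have := E (lshift n2 i); rewrite !mcatL.
by have := E (rshift n1 i); rewrite !mcatR.
Qed.

Lemma wt_mcat a b u v : wt (fcat a b) (mcat u v) = (wt a u + wt b v)%N.
Proof.
rewrite /wt big_split_ord; congr (_ + _)%N; apply: eq_bigr => i _.
  by rewrite fcatL mcatL.
by rewrite fcatR mcatR.
Qed.

Definition pad1 u := mcat u ones.
Definition pad2 v := mcat ones v.

(** [h1] and [h2] send the padded block to the augmenting coordinate, since both carry the constant
    1; [g1] and [g2] are sections. *)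
Let h1 (j : 'I_(n1 + n2).+1) : 'I_n1.+1 :=
  if unlift ord0 j is Some i then
    match split i with inl x => lift ord0 x | inr _ => ord0 end
  else ord0.
Let g1 (j : 'I_n1.+1) : 'I_(n1 + n2).+1 :=
  if unlift ord0 j is Some i then lift ord0 (lshift n2 i) else ord0.
Let h2 (j : 'I_(n1 + n2).+1) : 'I_n2.+1 :=
  if unlift ord0 j is Some i then
    match split i with inl _ => ord0 | inr y => lift ord0 y end
  else ord0.
Let g2 (j : 'I_n2.+1) : 'I_(n1 + n2).+1 :=
  if unlift ord0 j is Some i then lift ord0 (rshift n1 i) else ord0.

Let hg1 : cancel g1 h1.
Proof.
move=> j; rewrite /g1 /h1; case: (unliftP ord0 j) => [x|] ->.
  by rewrite liftK (unsplitK (inl x)).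
by rewrite unlift_none.
Qed.

Let hg2 : cancel g2 h2.
Proof.
move=> j; rewrite /g2 /h2; case: (unliftP ord0 j) => [x|] ->.
  by rewrite liftK (unsplitK (inr x)).
by rewrite unlift_none.
Qed.

Let pad1E u j : augd 1 (pad1 u) j = augd 1 u (h1 j).
Proof.
rewrite /h1; case: (unliftP ord0 j) => [i|] ->; last by rewrite !augd0E.
rewrite augdSE; case: (split_ordP i) => x ->.
  by rewrite mcatL augdSE.
by rewrite mcatR augd0E onesE.
Qed.

Let pad2E v j : augd 1 (pad2 v) j = augd 1 v (h2 j).
Proof.
rewrite /h2; case: (unliftP ord0 j) => [i|] ->; last by rewrite !augd0E.
rewrite augdSE; case: (split_ordP i) => x ->.
  by rewrite mcatL augd0E onesE.
by rewrite mcatR augdSE.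
Qed.

Lemma pad1_inj : injective pad1.
Proof. by move=> u u' /mcat_inj[]. Qed.
Lemma pad2_inj : injective pad2.
Proof. by move=> u u' /mcat_inj[]. Qed.

Lemma spread_pad1 s : spread (map pad1 s) = spread s.
Proof. exact: spread_padding hg1 pad1E s. Qed.
Lemma spread_pad2 s : spread (map pad2 s) = spread s.
Proof. exact: spread_padding hg2 pad2E s. Qed.

Lemma size_sumset_pad1 s : size (sumset (map pad1 s) (map pad1 s)) = size (sumset s s).
Proof. exact: size_sumset_padding hg1 pad1E s. Qed.
Lemma size_sumset_pad2 s : size (sumset (map pad2 s) (map pad2 s)) = size (sumset s s).
Proof. exact: size_sumset_padding hg2 pad2E s. Qed.

Variables (s1 : seq 'X_{1..n1}) (s2 : seq 'X_{1..n2}).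
Local Notation t1 := (map pad1 s1).
Local Notation t2 := (map pad2 s2).

Variables (a : 'I_n1 -> nat) (d1 : nat).
Hypothesis a_s1 : {in s1, forall m, wt a m = d1}.
Hypothesis d1_lt : (d1 < wt a ones)%N.

(** This weight reads the first block only: it is [d1] on [t1] and the larger [wt a ones] on
    [t2]. *)
Let la := fcat a (fun=> 0%N).

Let la_pad1 u : u \in s1 -> wt la (pad1 u) = d1.
Proof. by move=> /a_s1 us; rewrite wt_mcat us /wt big1 ?addn0. Qed.

Let la_pad2 v : wt la (pad2 v) = wt a ones.
Proof. by rewrite wt_mcat [X in (_ + X)%N]/wt big1 ?addn0. Qed.

(* On the span of t1 every coordinate of the second block equals the augmenting
   coordinate x0 and the a-weight is d1 x0; on the span of t2 every coordinate of
   the first block equals x0.  In the intersection, (wt a ones - d1) x0 = 0. *)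
Lemma spread_join : spread (t1 ++ t2) = (spread s1 + spread s2)%N.
Proof.
rewrite -[in RHS]spread_pad1 -[in RHS]spread_pad2 /spread.
set A1 := rows_mx _ t1; set A2 := rows_mx _ t2.
rewrite -mxrank_disjoint_sum.
  apply/eqP; rewrite eqn_leq; apply/andP; split; apply: mxrankS.
    apply/rows_mx_subP => m; rewrite mem_cat => /orP[]/rows_mx_mem mt.
      exact: submx_trans (mt _ _ _) (addsmxSl _ _).
    exact: submx_trans (mt _ _ _) (addsmxSr _ _).
  by rewrite addsmx_sub !rows_mx_sub // => m mt; rewrite mem_cat mt ?orbT.
pose L i : 'I_(n1 + n2).+1 := lift ord0 (lshift n2 i).
pose Rr i : 'I_(n1 + n2).+1 := lift ord0 (rshift n1 i).
have x1P (x : 'rV[rat]_(n1 + n2).+1) : (x <= A1)%MS -> (forall y, x 0 (Rr y) = x 0 ord0) /\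
    \sum_i (a i)%:R * x 0 (L i) = d1%:R * x 0 ord0.
  apply: (rows_mx_span_ind (P := fun x : 'rV[rat]_(n1 + n2).+1 =>
    (forall y, x 0 (Rr y) = x 0 ord0) /\
    \sum_i (a i)%:R * x 0 (L i) = d1%:R * x 0 ord0)).
  - by split=> [y|]; rewrite ?mxE ?mulr0 // big1 // => i _; rewrite mxE mulr0.
  - move=> c u v [u1 u2] [v1 v2]; split=> [y|]; first by rewrite !mxE u1 v1.
    rewrite !mxE mulrDr mulrCA -u2 -v2 mulr_sumr -big_split.
    by apply: eq_bigr => i _; rewrite !mxE mulrDr mulrCA.
  - move=> _ /mapP[u us ->]; split=> [y|].
      by rewrite !mxE augdSE augd0E mcatR onesE.
    rewrite mxE augd0E mulr1 -(a_s1 us) /wt natr_sum; apply: eq_bigr => i _.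
    by rewrite mxE augdSE mcatL natrM.
have x2P (x : 'rV[rat]_(n1 + n2).+1) : (x <= A2)%MS -> forall i, x 0 (L i) = x 0 ord0.
  apply: (rows_mx_span_ind (P := fun x : 'rV[rat]_(n1 + n2).+1 => forall i, x 0 (L i) = x 0 ord0)).
  - by move=> i; rewrite !mxE.
  - by move=> c u v u0 v0 i; rewrite !mxE u0 v0.
  - by move=> _ /mapP[v vs ->] i; rewrite !mxE augdSE augd0E mcatL onesE.
apply/eqP; rewrite -submx0; apply/rV_subP => x; rewrite sub_capmx => /andP[/x1P[xR xa] /x2P xL].
have x0 : x 0 ord0 = 0.
  move: xa; under eq_bigr do rewrite xL.
  rewrite -mulr_suml => /eqP; rewrite -subr_eq0 -mulrBl mulf_eq0 => /orP[|/eqP//].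
  rewrite -natr_sum subr_eq0 eqr_nat => /eqP aE.
  have := d1_lt; rewrite -aE /wt; under [X in (_ < X)%N]eq_bigr do rewrite onesE muln1.
  by rewrite ltnn.
rewrite submx0; apply/eqP/rowP => j; rewrite [RHS]mxE.
case: (unliftP ord0 j) => [i|] ->; last exact: x0.
by case: (split_ordP i) => z ->; rewrite -?/(L z) -?/(Rr z) ?xL ?xR x0.
Qed.

(** Under [la] the sums within [t1], the mixed sums and the sums within [t2] have three different
    weights, so they do not overlap; a mixed sum determines both summands, whence the product. *)
Lemma size_sumset_join : uniq s1 -> uniq s2 ->
  size (sumset (t1 ++ t2) (t1 ++ t2)) =
  (size (sumset s1 s1) + size (sumset s2 s2) + size s1 * size s2)%N.
Proof.
move=> us1 us2; rewrite -size_sumset_pad1 -size_sumset_pad2.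
have <- : size (sumset t1 t2) = (size s1 * size s2)%N.
  rewrite /sumset undup_id ?size_allpairs ?size_map //.
  apply: allpairs_uniq; rewrite ?(map_inj_uniq pad1_inj) ?(map_inj_uniq pad2_inj) //.
  move=> [x y] [x' y'] /allpairsP[[u v] [/= /mapP[u' _ ->] /mapP[v' _ ->] [-> ->]]].
  move=> /allpairsP[[w z] [/= /mapP[w' _ ->] /mapP[z' _ ->] [-> ->]]].
  by rewrite !mcatD => /mcat_inj[/addIm-> /addmI->].
rewrite -!size_cat; apply/perm_size/uniq_perm; rewrite ?undup_uniq //.
  have wt11 m : m \in sumset t1 t1 -> wt la m = (d1 + d1)%N.
    case/sumsetP => _ [_ [/mapP[u us ->] /mapP[v vs ->] ->]].
    by rewrite wtD !la_pad1.
  have wt22 m : m \in sumset t2 t2 -> wt la m = (wt a ones + wt a ones)%N.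
    by case/sumsetP => _ [_ [/mapP[u us ->] /mapP[v vs ->] ->]]; rewrite wtD !la_pad2.
  have wt12 m : m \in sumset t1 t2 -> wt la m = (d1 + wt a ones)%N.
    by case/sumsetP => _ [_ [/mapP[u us ->] /mapP[v vs ->] ->]]; rewrite wtD la_pad1 ?la_pad2.
  rewrite !cat_uniq !undup_uniq !andbT andTb; apply/andP; split.
    by apply/hasPn => m /wt22 E; apply/negP => /wt11; rewrite E => ?; lia.
  apply/hasPn => m /wt12 E; rewrite mem_cat; apply/norP.
  by split; [apply/negP => /wt11|apply/negP => /wt22]; rewrite E => ?; lia.
move=> m; rewrite !mem_cat; apply/sumsetP/idP.
  move=> [x [y []]]; rewrite !mem_cat => /orP[]xt /orP[]yt ->.
  - by rewrite mem_sumset.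
  - by rewrite (mem_sumset xt yt) orbT.
  - by rewrite addmC (mem_sumset yt xt) orbT.
  - by rewrite (mem_sumset xt yt) orbT.
by move=> /orP[/orP[]|] /sumsetP[x [y [xt yt ->]]]; exists x, y; rewrite !mem_cat xt yt ?orbT.
Qed.

End Concatenation.

Lemma quasi_equigenerated_gens (k : fieldType) n (I : set {mpoly k[n]}) :
  quasi_equigenerated I -> exists s a d, [/\ I = monomial_gen s, uniq s,
    forall i, (0 < a i)%N & {in s, forall m, wt a m = d}].
Proof.
move=> [s smin [a [a_gt0 [d wt_s]]]]; exists s, a, d; split=> //.
  by case: smin.
exact: min_monomial_gens_uniq smin.
Qed.

(** * Vertex covers of a join *)

Section JoinCover.
Variables (k : fieldType) (n1 n2 : nat) (G1 : sgraph n1) (G2 : sgraph n2).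

(** A set missing a vertex on each side leaves the join edge between these two uncovered. *)
Lemma join_coverP u v : is_cover (join G1 G2) (mcat u v) <->
  (is_cover G1 u /\ (ones <= v)%MM) \/ ((ones <= u)%MM /\ is_cover G2 v).
Proof.
have onesP n (m : 'X_{1..n}) : reflect (forall i, m i != 0%N) (ones <= m)%MM.
  apply: (iffP mnm_lepP) => H i; first by have := H i; rewrite onesE lt0n.
  by rewrite onesE lt0n.
have adjE x y : join G1 G2 x y = join_adj G1 G2 x y by [].
split=> [uv|H i j].
  have uG : is_cover G1 u.
    move=> i j Gij; have := uv (lshift n2 i) (lshift n2 j); rewrite !mcatL; apply.
    by rewrite adjE /join_adj !(unsplitK (inl _)).
  have vG : is_cover G2 v.
    move=> i j Gij; have := uv (rshift n1 i) (rshift n1 j); rewrite !mcatR; apply.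
    by rewrite adjE /join_adj !(unsplitK (inr _)).
  have [u1|] := boolP (ones <= u)%MM; first by right.
  move/onesP => u1; left; split=> //; apply/onesP => j; apply/negP => /eqP vj.
  apply: u1 => i; have := uv (lshift n2 i) (rshift n1 j); rewrite mcatL mcatR vj orbF.
  by apply; rewrite adjE /join_adj (unsplitK (inl _)) (unsplitK (inr _)).
rewrite adjE /join_adj !mnmE /fcat.
case: (split i) => x; case: (split j) => y Gxy.
- by case: H => [[uG _]|[/onesP u1 _]]; [apply: uG | rewrite u1].
- by case: H => [[_ /onesP v1]|[/onesP u1 _]]; rewrite ?v1 ?u1 ?orbT.
- by case: H => [[_ /onesP v1]|[/onesP u1 _]]; rewrite ?v1 ?u1 ?orbT.
- by case: H => [[_ /onesP v1]|[_ vG]]; [rewrite v1 | apply: vG].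
Qed.

Variables (s1 : seq 'X_{1..n1}) (s2 : seq 'X_{1..n2}).
Hypothesis E1 : cover_ideal k G1 = monomial_gen s1.
Hypothesis E2 : cover_ideal k G2 = monomial_gen s2.

Lemma join_cover_ideal :
  cover_ideal k (join G1 G2) =
  monomial_gen (map (@pad1 n1 n2) s1 ++ map (@pad2 n1 n2) s2).
Proof.
have C1 := (cover_ideal_monomialP k G1 s1).1 E1.
have C2 := (cover_ideal_monomialP k G2 s2).1 E2.
apply/cover_ideal_monomialP => m; have [u [v ->]] := mcat_surj m.
rewrite join_coverP C1 C2; split.
  case=> [[[w ws wu] v1]|[u1 [w ws wv]]].
    exists (pad1 n2 w); first by rewrite mem_cat map_f.
    by rewrite mcat_le wu.
  exists (pad2 n1 w); first by rewrite mem_cat map_f ?orbT.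
  by rewrite mcat_le u1.
case=> w; rewrite mem_cat => /orP[] /mapP[x xs ->]; rewrite mcat_le => /andP[le1 le2].
  by left; split=> //; exists x.
by right; split=> //; exists x.
Qed.

Lemma join_cover_ideal_empty2 : n2 = 0%N ->
  cover_ideal k (join G1 G2) = monomial_gen (map (@pad1 n1 n2) s1).
Proof.
move=> n20; have C1 := (cover_ideal_monomialP k G1 s1).1 E1.
apply/cover_ideal_monomialP => m.
rewrite ((cover_ideal_monomialP k _ _).1 join_cover_ideal m); split=> -[w ws wm]; last first.
  by exists w; rewrite // mem_cat ws.
move: ws; rewrite mem_cat => /orP[ws|/mapP[x xs wE]]; first by exists w.
have /C1[u us u1] := @ones_cover _ G1; exists (pad1 n2 u); first exact: map_f.
apply: lepm_trans wm; rewrite wE mcat_le u1; apply/mnm_lepP => i.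
by have := ltn_ord i; rewrite {2}n20.
Qed.

Lemma join_cover_ideal_empty1 : n1 = 0%N ->
  cover_ideal k (join G1 G2) = monomial_gen (map (@pad2 n1 n2) s2).
Proof.
move=> n10; have C2 := (cover_ideal_monomialP k G2 s2).1 E2.
apply/cover_ideal_monomialP => m.
rewrite ((cover_ideal_monomialP k _ _).1 join_cover_ideal m); split=> -[w ws wm]; last first.
  by exists w; rewrite // mem_cat ws orbT.
move: ws; rewrite mem_cat => /orP[/mapP[x xs wE]|ws]; last by exists w.
have /C2[u us u1] := @ones_cover _ G2; exists (pad2 n1 u); first exact: map_f.
apply: lepm_trans wm; rewrite wE mcat_le u1 andbT; apply/mnm_lepP => i.
by have := ltn_ord i; rewrite {2}n10.
Qed.

End JoinCover.

(** Without variables the ideal is generated by 1, and its fiber cone is k[t]: rank and number of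
    generators are both 1. *)
Lemma cover_ideal_empty (k : fieldType) n (G : sgraph n) : n = 0%N ->
  quasi_equigenerated (cover_ideal k G) ->
  freiman (cover_ideal k G) /\ linear_type (cover_ideal k G).
Proof.
move=> n0 /quasi_equigenerated_gens[s [a [d [E us a_gt0 wt_s]]]].
have all0 (m : 'X_{1..n}) : m = 0%MM.
  by apply/mnmP => i; have := ltn_ord i; rewrite {2}n0.
have C := (cover_ideal_monomialP k G s).1 E.
have sE : s = [:: 0%MM].
  have /C[u us' _] := @ones_cover _ G.
  case: (s) us us' => [//|x [|y t]]; first by rewrite (all0 x).
  by rewrite (all0 x) (all0 y) /= mem_head.
have sp : spread s = 1%N.
  apply/eqP; rewrite eqn_leq; apply/andP; split.
    by apply: leq_trans (spread_le_size s) _; rewrite sE.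
  rewrite lt0n mxrank_eq0 sE; apply/eqP => /matrixP/(_ ord0 ord0).
  by rewrite !mxE augd0E => /eqP; rewrite oner_eq0.
rewrite E (freiman_numbers k a_gt0 wt_s us) (linear_type_numbers k a_gt0 wt_s us) sp sE.
by [].
Qed.

(** With c = r + x on each side, the joint defect is the sum of the two defects and x1 x2; being
    nonnegative, all three vanish together. *)
Lemma freiman_arith r1 r2 c1 c2 q1 q2 : (r1 <= c1 -> r2 <= c2 ->
  r1 * c1 <= q1 + 'C(r1, 2) -> r2 * c2 <= q2 + 'C(r2, 2) ->
  q1 + q2 + c1 * c2 + 'C(r1 + r2, 2) = (r1 + r2) * (c1 + c2) <->
  [/\ q1 + 'C(r1, 2) = r1 * c1, q2 + 'C(r2, 2) = r2 * c2 & r1 = c1 \/ r2 = c2])%N.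
Proof.
move=> /subnKC; move: (c1 - r1)%N => x1 <- /subnKC; move: (c2 - r2)%N => x2 <-.
have -> : ('C(r1 + r2, 2) = 'C(r1, 2) + 'C(r2, 2) + r1 * r2)%N.
  by elim: r1 => [|r1 IHr]; rewrite ?bin0n ?add0n ?addn0 // addSn !binS !bin1 IHr; lia.
move: 'C(r1, 2) 'C(r2, 2) => y1 y2 le1 le2; split=> [E|[E3 E4 E5]].
  have : (x1 * x2 = 0)%N by nia.
  by move/eqP; rewrite muln_eq0 => /orP[]/eqP x0; split; nia.
by case: E5 => x0; nia.
Qed.

(** * Equivalence for joins of graphs *)

Theorem theorem4p4 (k : fieldType) (n1 n2 : nat)
    (G1 : sgraph n1) (G2 : sgraph n2)
    (hI1 : quasi_equigenerated (cover_ideal k G1))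
    (hI2 : quasi_equigenerated (cover_ideal k G2)) :
  freiman (cover_ideal k (join G1 G2)) <->
  [/\ freiman (cover_ideal k G1), freiman (cover_ideal k G2) &
      linear_type (cover_ideal k G1) \/ linear_type (cover_ideal k G2)].
Proof.
have [s1 [a1 [d1 [E1 us1 a1_gt0 wt_s1]]]] := quasi_equigenerated_gens hI1.
have [s2 [a2 [d2 [E2 us2 a2_gt0 wt_s2]]]] := quasi_equigenerated_gens hI2.
have fcat_gt0 (f : 'I_n1 -> nat) (g : 'I_n2 -> nat) : (forall i, 0 < f i)%N ->
    (forall i, 0 < g i)%N -> forall i, (0 < fcat f g i)%N.
  by move=> f_gt0 g_gt0 i; rewrite /fcat; case: (split i).
(* An empty graph is treated apart, because the strict weight gap fails there; its ideal is Freiman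
   and of linear type, so only the other graph counts. *)
have [n20|n2_gt0] := posnP n2.
  have [F2 L2] := cover_ideal_empty n20 hI2.
  suff -> : freiman (cover_ideal k (join G1 G2)) <-> freiman (cover_ideal k G1).
    by split=> [F1|[]//]; split=> //; right.
  have ut : uniq (map (@pad1 n1 n2) s1) by rewrite (map_inj_uniq (@pad1_inj n1 n2)).
  have wt_t : {in map (@pad1 n1 n2) s1, forall m, wt (fcat a1 a2) m = d1 + wt a2 ones}%N.
    by move=> _ /mapP[u us ->]; rewrite wt_mcat wt_s1.
  rewrite (join_cover_ideal_empty2 E1 E2 n20) E1.
  rewrite (freiman_numbers k (fcat_gt0 _ _ a1_gt0 a2_gt0) wt_t ut).
  rewrite (freiman_numbers k a1_gt0 wt_s1 us1).
  by rewrite spread_pad1 size_sumset_pad1 size_map.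
have [n10|n1_gt0] := posnP n1.
  have [F1 L1] := cover_ideal_empty n10 hI1.
  suff -> : freiman (cover_ideal k (join G1 G2)) <-> freiman (cover_ideal k G2).
    by split=> [F2|[]//]; split=> //; left.
  have ut : uniq (map (@pad2 n1 n2) s2) by rewrite (map_inj_uniq (@pad2_inj n1 n2)).
  have wt_t : {in map (@pad2 n1 n2) s2, forall m, wt (fcat a1 a2) m = wt a1 ones + d2}%N.
    by move=> _ /mapP[u us ->]; rewrite wt_mcat wt_s2.
  rewrite (join_cover_ideal_empty1 E1 E2 n10) E2.
  rewrite (freiman_numbers k (fcat_gt0 _ _ a1_gt0 a2_gt0) wt_t ut).
  rewrite (freiman_numbers k a2_gt0 wt_s2 us2).
  by rewrite spread_pad2 size_sumset_pad2 size_map.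
have d1_lt := cover_gen_wt_lt E1 a1_gt0 wt_s1 n1_gt0.
have d2_lt := cover_gen_wt_lt E2 a2_gt0 wt_s2 n2_gt0.
pose t := map (@pad1 n1 n2) s1 ++ map (@pad2 n1 n2) s2.
have ut : uniq t.
  rewrite cat_uniq (map_inj_uniq (@pad1_inj n1 n2)) (map_inj_uniq (@pad2_inj n1 n2)).
  rewrite us1 us2 andbT /=; apply/hasPn => _ /mapP[v vs ->]; apply/mapP => -[u us].
  by case/mcat_inj => u1 _; move: d1_lt; rewrite u1 (wt_s1 _ us) ltnn.
(* Scaling each block by the weight gap of the other equalizes the weights: [pad2 v] exceeds
   [pad1 u] by [c2 * c1] on the first block and falls short by [c1 * c2] on the second. *)
pose c1 := (wt a1 ones - d1)%N; pose c2 := (wt a2 ones - d2)%N.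
pose b := fcat (fun i => c2 * a1 i)%N (fun i => c1 * a2 i)%N.
have b_gt0 i : (0 < b i)%N.
  by apply: fcat_gt0 => j; rewrite muln_gt0 ?a1_gt0 ?a2_gt0 subn_gt0 ?d1_lt ?d2_lt.
have wtZ n (a : 'I_n -> nat) c m : wt (fun i => c * a i)%N m = (c * wt a m)%N.
  by rewrite /wt big_distrr; apply: eq_bigr => i _; rewrite /= mulnA.
have wt_t : {in t, forall m, wt b m = c2 * d1 + c1 * wt a2 ones}%N.
  move=> m; rewrite mem_cat => /orP[]/mapP[u us ->]; rewrite wt_mcat !wtZ.
    by rewrite (wt_s1 _ us).
  rewrite (wt_s2 _ us) /c1 /c2; move: (wt a1 ones) (wt a2 ones) d1_lt d2_lt => w1 w2.
  move=> /ltnW/subnKC; move: (w1 - d1)%N => x1 <- /ltnW/subnKC.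
  by move: (w2 - d2)%N => x2 <-; lia.
rewrite (join_cover_ideal E1 E2) E1 E2.
have F1 := freiman_numbers k a1_gt0 wt_s1 us1.
have F2 := freiman_numbers k a2_gt0 wt_s2 us2.
have L1 := linear_type_numbers k a1_gt0 wt_s1 us1.
have L2 := linear_type_numbers k a2_gt0 wt_s2 us2.
rewrite (freiman_numbers k b_gt0 wt_t ut).
rewrite (spread_join s2 wt_s1 d1_lt) (size_sumset_join wt_s1 d1_lt us1 us2) size_cat !size_map.
rewrite freiman_arith ?spread_le_size ?spread_freiman_inequality //.
split=> -[/F1 f1 /F2 f2 l]; split=> //.
  by case: l => [/L1|/L2] l; [left|right].
by case: l => [/L1|/L2] l; [left|right].
Qed.
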